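(* Consider the functions $w^{\blacktriangle,I}_{ijk}$, $w^{\blacktriangle,II,\mathcal N}_{ijk}$, $w^{\blacktriangle,III,\mathcal N}_{ijk}$ ($i\ge2$, $j,k\ge1$), $w^{\blacktriangle,I}_{1jk}$, $w^{\blacktriangle,IV}_{1jk}$ ($j,k\ge1$) and $w^{\blacktriangle,I}_{10k}$ ($k\ge1$), and correspondingly the functions $b^{\blacktriangle,I}_{ijk}$, $b^{\blacktriangle,II}_{ijk}$, $b^{\blacktriangle,III}_{ijk}$, $b^{\blacktriangle,I}_{1jk}$, $b^{\blacktriangle,IV}_{1jk}$, $b^{\blacktriangle}_{10k}$ with the same index ranges, all as defined in the context. These two systems are biorthogonal with respect to $\langle w,b\rangle=\int_{\blacktriangle}w\cdot b\;\mathrm d(x,y,z)$, i.e. up to scaling: $\langle w,b\rangle=0$ whenever $w$ and $b$ do not correspond to each other (different type or different indices), and $\langle w,b\rangle\neq0$ when $w$ and $b$ have the same type and the same indices.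
   Context: $\blacktriangle$ is the tetrahedron with vertices $(-1,-1,-1)$, $(1,-1,-1)$, $(0,1,-1)$, $(0,0,1)$. $P_n^{(\alpha,\beta)}$ are the Jacobi polynomials on $[-1,1]$ in the standard (Rodrigues) normalization, $L_n=P_n^{(0,0)}$, $\hat P_n^\alpha(x)=\int_{-1}^xP_{n-1}^{(\alpha,0)}(t)\,\mathrm dt$ for $n\ge1$, $\hat L_n=\hat P_n^0$. Write $\eta=\frac{4x}{1-2y-z}$, $\chi=\frac{2y}{1-z}$, $\omega=\frac{1-2y-z}{4}$, $\omega_y=\frac{1-z}{2}$. Auxiliary functions: for $i\ge2$, $j,k\ge1$: $f_i=\hat L_i(\eta)\omega^i$, $g_{i,j}=\hat P_j^{2i}(\chi)\omega_y^j$, $h_{i,j,k}=\hat P_k^{2i+2j}(z)$. Moreover $g^{\mathcal N}_j=\hat P_j^3(\chi)\omega_y^j$, $h^{\mathcal N,j}_k=\hat P_k^{2j+3}(z)$, $v^{\mathcal N_0}_{[1,2]}=-\frac18(1-2y-z,2x,x)^\top$, $w_1^{\blacktriangle,F_1}=-\frac18(-x,-y,1-z)^\top$. Primal functions (arguments and indices of $f=f_i$, $g=g_{i,j}$, $h=h_{i,j,k}$ omitted): $w^{\blacktriangle,I}_{ijk}=i f\nabla g\times\nabla h+j g\nabla h\times\nabla f+k h\nabla f\times\nabla g$; $w^{\blacktriangle,II,\mathcal N}_{ijk}=i f\nabla g\times\nabla h+j g\nabla h\times\nabla f-(i+j)h\nabla f\times\nabla g$; $w^{\blacktriangle,III,\mathcal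 N}_{ijk}=-i f\nabla g\times\nabla h+(i+k)g\nabla h\times\nabla f-k h\nabla f\times\nabla g$; $w^{\blacktriangle,IV}_{1jk}=\mathrm{curl}\bigl(v^{\mathcal N_0}_{[1,2]}g^{\mathcal N}_jh^{\mathcal N,j}_k\bigr)$; $w^{\blacktriangle,I}_{1jk}=(j+2)g^{\mathcal N}_j(\nabla h^{\mathcal N,j}_k\times v^{\mathcal N_0}_{[1,2]})-k h^{\mathcal N,j}_k(\nabla g^{\mathcal N}_j\times v^{\mathcal N_0}_{[1,2]})-k g^{\mathcal N}_jh^{\mathcal N,j}_k\,\mathrm{curl}\,v^{\mathcal N_0}_{[1,2]}$; $w^{\blacktriangle,I}_{10k}=4\,w_1^{\blacktriangle,F_1}\hat P_k^4(z)$. Auxiliary dual functions, for $i\ge2$, $j,k\ge1$: $\widetilde b^I_{ijk}=-\frac12\,\omega^{i-1}\omega_y^{j}P_{j-1}^{(2i,0)}(\chi)P_{k-1}^{(2i+2j,0)}(z)\bigl(2iP_{i-2}^{(1,1)}(\eta),\,(i+1)P_{i-1}^{(1,1)}(\eta),\,\frac12(i+1)P_{i-1}^{(1,1)}(\eta)\bigr)^\top$; $\widetilde b^{II}_{ijk}=(2i+j-1)\,\omega^{i-1}\omega_y^{j}L_{i-1}(\eta)P_{k-1}^{(2i+2j,0)}(z)\bigl(0,\,P_{j-1}^{(2i-1,1)}(\chi),\,\tilde R_j\bigr)^\top$ with $\tilde R_j=\frac{\chi}{2}P_{j-1}^{(2i-1,1)}(\chi)-\frac{j}{2i+j-1}\frac{1-\chi}{2}P_{j-1}^{(2i,0)}(\chi)$;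 $\widetilde b^{III}_{ijk}=(2i+2j+k-1)\,\omega^{i}\omega_y^{j-1}L_{i-1}(\eta)P_{j-1}^{(2i,0)}(\chi)P_{k-1}^{(2i+2j-1,1)}(z)(0,0,1)^\top$; and for $j,k\ge1$: $\widetilde b^{IV}_{1jk}=(2j+k+2)P_j^{(1,0)}(\chi)\omega_y^jP_{k-1}^{(2j+2,1)}(z)(0,0,1)^\top$; $\widetilde b^{I}_{1jk}=(j+2)\,\omega_y^{j}P_{k-1}^{(2j+3,0)}(z)\bigl(0,\,P_{j-1}^{(2,1)}(\chi),\,\frac12P_{j-1}^{(2,1)}(\chi)+P_j^{(1,1)}(\chi)\bigr)^\top$. Dual functions: with $\tilde c_{i,j,k}=\frac{(2i-1)(2i+2j-1)(2i+2j+2k-1)}{16\,i\,(i+j+k)}$, $b^{\blacktriangle,I}_{ijk}=\tilde c_{i,j,k}(i\widetilde b^I_{ijk}+i\widetilde b^{II}_{ijk}+i\widetilde b^{III}_{ijk})$, $\;b^{\blacktriangle,II}_{ijk}=\tilde c_{i,j,k}(k\widetilde b^I_{ijk}-i\widetilde b^{III}_{ijk})$, $\;b^{\blacktriangle,III}_{ijk}=\tilde c_{i,j,k}(-j\widetilde b^I_{ijk}+i\widetilde b^{II}_{ijk})$; with $d_{j,k}=-\frac{(j+1)(j+k+1)}{2(j+k+2)}$, $b^{\blacktriangle,I}_{1jk}=d_{j,k}(\widetilde b^I_{1jk}-\widetilde b^{IV}_{1jk})$, $\;b^{\blacktriangle,IV}_{1jk}=d_{j,k}(k\,\widetilde b^I_{1jk}+(j+2)\widetilde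 b^{IV}_{1jk})$; and $b^{\blacktriangle}_{10k}$ is given by $-\frac{(2k+3)(k+3)}{8}\,b^{\blacktriangle}_{10k}=P_{k-1}^{(3,1)}(z)(0,0,1)^\top$. Correspondence: $w^{\blacktriangle,I}_{ijk}\leftrightarrow b^{\blacktriangle,I}_{ijk}$, $w^{\blacktriangle,II,\mathcal N}_{ijk}\leftrightarrow b^{\blacktriangle,II}_{ijk}$, $w^{\blacktriangle,III,\mathcal N}_{ijk}\leftrightarrow b^{\blacktriangle,III}_{ijk}$, $w^{\blacktriangle,I}_{1jk}\leftrightarrow b^{\blacktriangle,I}_{1jk}$, $w^{\blacktriangle,IV}_{1jk}\leftrightarrow b^{\blacktriangle,IV}_{1jk}$, $w^{\blacktriangle,I}_{10k}\leftrightarrow b^{\blacktriangle}_{10k}$. *)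

(* Defs.v *)
From mathcomp Require Import all_boot all_order all_algebra.
From mathcomp Require Import all_classical all_reals all_analysis.

Set Implicit Arguments.
Unset Strict Implicit.
Unset Printing Implicit Defensive.

Import Order.TTheory GRing.Theory Num.Theory.
Import numFieldNormedType.Exports.

Local Open Scope classical_set_scope.
Local Open Scope ring_scope.

Section VectorCalculus.
Variable R : realType.
Local Notation R3 := (R * R * R)%type.
Implicit Types (u v p : R3) (f : R3 -> R) (w b : R3 -> R3).

Definition dot u v : R := u.1.1 * v.1.1 + u.1.2 * v.1.2 + u.2 * v.2.

Definition cross u v : R3 :=
  (u.1.2 * v.2 - u.2 * v.1.2,
   u.2 * v.1.1 - u.1.1 * v.2,
   u.1.1 * v.1.2 - u.1.2 * v.1.1).

Definition ex : R3 := (1, 0, 0).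
Definition ey : R3 := (0, 1, 0).
Definition ez : R3 := (0, 0, 1).

Definition grad f p : R3 := ('D_ex f p, 'D_ey f p, 'D_ez f p).

Definition curl w p : R3 :=
  let w1 q := (w q).1.1 in let w2 q := (w q).1.2 in let w3 q := (w q).2 in
  ('D_ey w3 p - 'D_ez w2 p,
   'D_ez w1 p - 'D_ex w3 p,
   'D_ex w2 p - 'D_ey w1 p).

Definition lebesgue3 : set R3 -> \bar R :=
  ((@lebesgue_measure R \x @lebesgue_measure R) \x @lebesgue_measure R)%E.

Definition tet_vertices : seq R3 :=
  [:: (-1, -1, -1); (1, -1, -1); (0, 1, -1); (0, 0, 1)].

Definition tet : set R3 :=
  [set p | exists t : 'I_4 -> R,
    [/\ forall i, 0 <= t i, \sum_i t i = 1
      & p = \sum_i t i *: tet_vertices`_i]].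

(* The Lebesgue integral of a non-integrable function takes a default value,
   so pairing is meaningful only together with pairing_integrable. *)
Definition pairing_integrable w b : Prop :=
  lebesgue3.-integrable tet (fun p => (dot (w p) (b p))%:E).

Definition pairing w b : R := \int[lebesgue3]_(p in tet) dot (w p) (b p).

End VectorCalculus.

Section Jacobi.
Variable R : realType.

(* Rodrigues' formula
     P_n^(a,b) = (-1)^n / (2^n n!) (1-x)^-a (1+x)^-b
                 (d/dx)^n [(1-x)^(a+n) (1+x)^(b+n)]
   for natural a and b.  The polynomial division is exact: every term of the
   n-th derivative still contains the factor (1-x)^a (1+x)^b. *)
Definition jacobi (n a b : nat) : {poly R} :=
  ((-1) ^+ n / (2 ^+ n * (n`!)%:R)) *:
    (((1 - 'X) ^+ (a + n) * (1 + 'X) ^+ (b + n))^`(n)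
       %/ ((1 - 'X) ^+ a * (1 + 'X) ^+ b)).

Definition legendre (n : nat) : {poly R} := jacobi n 0 0.

(* Only meaningful for 1 <= n and -1 <= x (the integral over `[-1, x] is not
   oriented), which is all that occurs on the tetrahedron. *)
Definition jacobi_hat (n a : nat) (x : R) : R :=
  \int[lebesgue_measure]_(t in `[-1, x]) (jacobi n.-1 a 0).[t].

Definition legendre_hat (n : nat) (x : R) : R := jacobi_hat n 0 x.

End Jacobi.

Section Bubbles.
Variable R : realType.
Local Notation R3 := (R * R * R)%type.
Implicit Types (i j k : nat) (p : R3).

Local Notation P n a b x := ((jacobi R n%N a%N b%N).[x]).
Local Notation L n x := ((legendre R n%N).[x]).

(* The denominators vanish only on a null subset of the tetrahedron: its edge
   1 - 2y - z = 0, which contains the vertex z = 1. *)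
Definition eta p : R := 4 * p.1.1 / (1 - 2 * p.1.2 - p.2).
Definition chi p : R := 2 * p.1.2 / (1 - p.2).
Definition omega p : R := (1 - 2 * p.1.2 - p.2) / 4.
Definition omega_y p : R := (1 - p.2) / 2.

Definition f_ i p : R := legendre_hat i (eta p) * omega p ^+ i.
Definition g_ i j p : R := jacobi_hat j (2 * i) (chi p) * omega_y p ^+ j.
Definition h_ i j k p : R := jacobi_hat k (2 * i + 2 * j) p.2.

Definition gN j p : R := jacobi_hat j 3 (chi p) * omega_y p ^+ j.
Definition hN j k p : R := jacobi_hat k (2 * j + 3) p.2.

Definition vN0 p : R3 :=
  - (1 / 8) *: (1 - 2 * p.1.2 - p.2, 2 * p.1.1, p.1.1).
Definition wF1 p : R3 := - (1 / 8) *: (- p.1.1, - p.1.2, 1 - p.2).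

Definition wI i j k p : R3 :=
  let f := f_ i in let g := g_ i j in let h := h_ i j k in
  (i%:R * f p) *: cross (grad g p) (grad h p)
  + (j%:R * g p) *: cross (grad h p) (grad f p)
  + (k%:R * h p) *: cross (grad f p) (grad g p).

Definition wII i j k p : R3 :=
  let f := f_ i in let g := g_ i j in let h := h_ i j k in
  (i%:R * f p) *: cross (grad g p) (grad h p)
  + (j%:R * g p) *: cross (grad h p) (grad f p)
  - ((i%:R + j%:R) * h p) *: cross (grad f p) (grad g p).

Definition wIII i j k p : R3 :=
  let f := f_ i in let g := g_ i j in let h := h_ i j k in
  - (i%:R * f p) *: cross (grad g p) (grad h p)
  + ((i%:R + k%:R) * g p) *: cross (grad h p) (grad f p)
  - (k%:R * h p) *: cross (grad f p) (grad g p).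

Definition w1IV j k : R3 -> R3 := curl (fun p => (gN j p * hN j k p) *: vN0 p).

Definition w1I j k p : R3 :=
  let g := gN j in let h := hN j k in
  ((j%:R + 2) * g p) *: cross (grad h p) (vN0 p)
  - (k%:R * h p) *: cross (grad g p) (vN0 p)
  - (k%:R * g p * h p) *: curl vN0 p.

Definition w10 k p : R3 := (4 * jacobi_hat k 4 p.2) *: wF1 p.

Definition bI_aux i j k p : R3 :=
  (- (1 / 2) * omega p ^+ (i - 1) * omega_y p ^+ j
   * P (j - 1) (2 * i) 0 (chi p) * P (k - 1) (2 * i + 2 * j) 0 p.2) *:
  (2 * i%:R * P (i - 2) 1 1 (eta p),
   (i%:R + 1) * P (i - 1) 1 1 (eta p),
   1 / 2 * (i%:R + 1) * P (i - 1) 1 1 (eta p)).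

Definition R_aux i j (c : R) : R :=
  c / 2 * P (j - 1) (2 * i - 1) 1 c
  - j%:R / (2 * i%:R + j%:R - 1) * ((1 - c) / 2) * P (j - 1) (2 * i) 0 c.

Definition bII_aux i j k p : R3 :=
  ((2 * i%:R + j%:R - 1) * omega p ^+ (i - 1) * omega_y p ^+ j
   * L (i - 1) (eta p) * P (k - 1) (2 * i + 2 * j) 0 p.2) *:
  (0, P (j - 1) (2 * i - 1) 1 (chi p), R_aux i j (chi p)).

Definition bIII_aux i j k p : R3 :=
  ((2 * i%:R + 2 * j%:R + k%:R - 1) * omega p ^+ i * omega_y p ^+ (j - 1)
   * L (i - 1) (eta p) * P (j - 1) (2 * i) 0 (chi p)
   * P (k - 1) (2 * i + 2 * j - 1) 1 p.2) *:
  (0, 0, 1).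

Definition b1IV_aux j k p : R3 :=
  ((2 * j%:R + k%:R + 2) * P j 1 0 (chi p) * omega_y p ^+ j
   * P (k - 1) (2 * j + 2) 1 p.2) *:
  (0, 0, 1).

Definition b1I_aux j k p : R3 :=
  ((j%:R + 2) * omega_y p ^+ j * P (k - 1) (2 * j + 3) 0 p.2) *:
  (0, P (j - 1) 2 1 (chi p), 1 / 2 * P (j - 1) 2 1 (chi p) + P j 1 1 (chi p)).

Definition c_coef i j k : R :=
  (2 * i%:R - 1) * (2 * i%:R + 2 * j%:R - 1)
  * (2 * i%:R + 2 * j%:R + 2 * k%:R - 1)
  / (16 * i%:R * (i%:R + j%:R + k%:R)).

Definition bI i j k p : R3 :=
  c_coef i j k *: (i%:R *: bI_aux i j k p + i%:R *: bII_aux i j k p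
                   + i%:R *: bIII_aux i j k p).

Definition bII i j k p : R3 :=
  c_coef i j k *: (k%:R *: bI_aux i j k p - i%:R *: bIII_aux i j k p).

Definition bIII i j k p : R3 :=
  c_coef i j k *: (- j%:R *: bI_aux i j k p + i%:R *: bII_aux i j k p).

Definition d_coef j k : R :=
  - ((j%:R + 1) * (j%:R + k%:R + 1) / (2 * (j%:R + k%:R + 2))).

Definition b1I j k p : R3 :=
  d_coef j k *: (b1I_aux j k p - b1IV_aux j k p).

Definition b1IV j k p : R3 :=
  d_coef j k *: (k%:R *: b1I_aux j k p + (j%:R + 2) *: b1IV_aux j k p).

Definition b10 k p : R3 :=
  (- ((2 * k%:R + 3) * (k%:R + 3) / 8))^-1 *:
    (P (k - 1) 3 1 p.2 *: ((0, 0, 1) : R3)).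

End Bubbles.

Inductive bubble : Set :=
  | TypeI of nat & nat & nat
  | TypeII of nat & nat & nat
  | TypeIII of nat & nat & nat
  | Type1I of nat & nat
  | Type1IV of nat & nat
  | Type10 of nat.

Definition in_range (s : bubble) : bool :=
  match s with
  | TypeI i j k | TypeII i j k | TypeIII i j k =>
      [&& 2 <= i, 1 <= j & 1 <= k]%N
  | Type1I j k | Type1IV j k => [&& 1 <= j & 1 <= k]%N
  | Type10 k => (1 <= k)%N
  end.

Definition primal (R : realType) (s : bubble) : R * R * R -> R * R * R :=
  match s with
  | TypeI i j k => @wI R i j k
  | TypeII i j k => @wII R i j k
  | TypeIII i j k => @wIII R i j k
  | Type1I j k => @w1I R j k
  | Type1IV j k => @w1IV R j k
  | Type10 k => @w10 R k
  end.

Definition dual (R : realType) (s : bubble) : R * R * R -> R * R * R :=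
  match s with
  | TypeI i j k => @bI R i j k
  | TypeII i j k => @bII R i j k
  | TypeIII i j k => @bIII R i j k
  | Type1I j k => @b1I R j k
  | Type1IV j k => @b1IV R j k
  | Type10 k => @b10 R k
  end.

Arguments primal : clear implicits.
Arguments dual : clear implicits.

(* Main.v *)
(* In the coordinates eta, chi, z the primal functions are contravariant
   (Piola) images of vector fields whose components are products of a function
   of eta, namely hat L_i or L_(i-1), and a polynomial in chi and z; dually, the
   covariant components of the dual functions carry L_(i-1)' or L_(i-1).  Both
   eta integrals in the pairing reduce, by parts, to the orthogonality of the
   Legendre polynomials, and what remains is a bilinear form in the two
   (chi, z)-coefficient triples.  With respect to it the elementary fields
   f grad g x grad h, g grad h x grad f, h grad f x grad g are biorthogonal to
   the auxiliary dual functions, because P^(a,0) are orthogonal for (1 - x)^a and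
   d/dx ((1 - x)^(a+1) P_n^(a+1,0)) = - (a + 1 + n) (1 - x)^a P_n^(a,1); the
   theorem then only asserts orthogonality of explicit coefficient vectors.

   On the faces, where a factor jacobi_hat may fail to be differentiable (it is 0
   beyond the face), 'D takes the value 0, be it a derivative or the default
   value.  Hence, pointwise on the tetrahedron, the integrand is a polynomial in
   eta, chi, z times the indicator function of a half-open tetrahedron. *)

From HB Require Import structures.
Require Import Defs.
From mathcomp Require Import all_boot all_order all_algebra.
From mathcomp Require Import all_classical all_reals all_analysis.
From mathcomp Require Import measurable_realfun ring lra zify.

Set Implicit Arguments.
Unset Strict Implicit.
Unset Printing Implicit Defensive.

Import Order.TTheory GRing.Theory Num.Theory.
Import numFieldNormedType.Exports.
Local Open Scope ring_scope.

(** * Integrals of polynomials *)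

Section PolynomialIntegral.
Variable R : realType.
Implicit Types (p q r w : {poly R}).

(** Integrals over [-1, 1] are taken through formal antiderivatives; measure theory enters only to
    identify the integral over the tetrahedron with products of these. The map from (eta, chi, z) to
    (x, y, z) has Jacobian [omega * omega_y], which is (1 - chi)/2 times ((1 - z)/2)^2; with it the
    powers carried by a primal and a dual function add up to the Jacobi weights. In z this happens
    only once the indices j agree, so the chi integral has to be settled first.

    The case i = 1 stands apart: hat L_1 does not vanish at 1, so an integration by parts in eta
    would leave a boundary term. None is needed, because [vN0] is - omega^2 / 2 times the gradient
    of eta and [wF1] is parallel to the derivative of (x, y, z) with respect to z: these primal
    functions have no eta component.

    The relations between different Jacobi polynomials come from one principle: a polynomial of
    degree at most n that is orthogonal to all lower degrees is determined by its coefficient of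
    degree n. *)

Definition prim p : {poly R} := \poly_(i < (size p).+1) (p`_i.-1 / i%:R).

(** At [i = 0] the quotient is a division by zero, hence 0: [prim p] has no constant term. *)
Lemma coef_prim p i : (prim p)`_i = p`_i.-1 / i%:R.
Proof.
rewrite coef_poly; case: ltnP => // le_i.
by case: i le_i => // i le_i; rewrite /= nth_default ?mul0r.
Qed.

Fact prim_is_linear : linear prim.
Proof.
move=> c p q; apply/polyP => i.
by rewrite coefD coefZ !coef_prim coefD coefZ mulrDl mulrA.
Qed.

HB.instance Definition _ :=
  GRing.isLinear.Build R {poly R} {poly R} *:%R prim prim_is_linear.

Lemma deriv_prim p : (prim p)^`() = p.
Proof.
apply/polyP => i; rewrite coef_deriv coef_prim -[LHS]mulr_natr -mulrA mulVf ?mulr1//.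
Qed.

Lemma prim_deriv p : prim p^`() = p - (p`_0)%:P.
Proof.
apply/polyP => -[|i]; rewrite coef_prim coefB coefC /=.
  by rewrite invr0 mulr0 subrr.
by rewrite coef_deriv -[_ *+ _]mulr_natr -mulrA divff ?mulr1 ?subr0// pnatr_eq0.
Qed.

Definition integ p : R := (prim p).[1] - (prim p).[-1].

Fact integ_is_linear : scalar integ.
Proof.
move=> c p q; rewrite /integ !linearP !hornerD !hornerZ/=. ring.
Qed.

HB.instance Definition _ :=
  GRing.isLinear.Build R {poly R} R *%R integ integ_is_linear.

Lemma integ_deriv p : integ p^`() = p.[1] - p.[-1].
Proof. by rewrite /integ prim_deriv !hornerE; ring. Qed.

Lemma integ_by_parts p q :
  integ (p^`() * q) = (p * q).[1] - (p * q).[-1] - integ (p * q^`()).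
Proof. by rewrite -integ_deriv derivM raddfD addrK. Qed.

Lemma integ_gt0 p : p != 0 -> (forall x, -1 <= x <= 1 -> 0 <= p.[x]) ->
  0 < integ p.
Proof.
move=> p0 pge0.
have homoP : {in `[-1, 1]%R &, {homo horner (prim p) : x y / x <= y}}.
  apply: ger0_derive1_le_cc.
  - by move=> x _; exact: derivable_horner.
  - move=> x; rewrite in_itv => /andP[x1 x2].
    by rewrite -derivE deriv_prim pge0// !ltW.
  - exact/continuous_subspaceT/continuous_horner.
have in1 : (1 : R) \in `[-1, 1]%R by rewrite in_itv/=; lra.
have inN1 : (-1 : R) \in `[-1, 1]%R by rewrite in_itv/=; lra.
have leN11 : (-1 : R) <= 1 by lra.
rewrite lt_neqAle subr_ge0 (homoP _ _ inN1 in1 leN11) andbT.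
apply: contra_neq p0 => /esym/eqP; rewrite subr_eq0 => /eqP eqP1.
have cstP x : -1 <= x <= 1 -> (prim p).[x] = (prim p).[1].
  move=> /andP[x1 x2]; have xI : x \in `[-1, 1]%R by rewrite in_itv/= x1 x2.
  apply/eqP; rewrite eq_le (homoP _ _ xI in1 x2) eqP1.
  exact: (homoP _ _ inN1 xI x1).
(* If the integral were 0, the monotone [prim p] would be constant on [-1, 1]. Then [q] has the
   roots 1, 1/2, 1/3, ..., more than its degree allows. *)
pose q := prim p - ((prim p).[1])%:P.
suff q0 : q = 0 by rewrite -(deriv_prim p) -[prim p](subrK ((prim p).[1])%:P)
  -/q q0 add0r derivC.
apply: (@roots_geq_poly_eq0 _ _ [seq i.+1%:R^-1 | i <- iota 0 (size q)]).
- apply/allP => _ /mapP[i _ ->]; apply/rootP; rewrite !hornerE cstP ?subrr//.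
  rewrite invf_le1 ?ltr0n// ler1n /= andbT.
  by apply: (@le_trans _ _ 0); [lra | rewrite invr_ge0].
- rewrite map_inj_uniq ?iota_uniq// => i j /invr_inj/eqP.
  by rewrite eqr_nat => /eqP[].
- by rewrite size_map size_iota.
Qed.

End PolynomialIntegral.

(** * Jacobi polynomials *)

Section JacobiPolynomials.
Variable R : realType.
Implicit Types (p q r : {poly R}) (a b n : nat).

Definition wt a b : {poly R} := (1 - 'X) ^+ a * (1 + 'X) ^+ b.

Local Notation J n a b := (jacobi R n a b).

Lemma size_1subX : size (1 - 'X : {poly R}) = 2.
Proof. by rewrite -opprB size_polyN -polyC1 size_XsubC. Qed.

Lemma size_1addX : size (1 + 'X : {poly R}) = 2.
Proof. by rewrite addrC -polyC1 size_XaddC. Qed.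

Lemma wt_neq0 a b : wt a b != 0.
Proof.
by rewrite mulf_neq0// expf_neq0// -size_poly_eq0 ?size_1subX ?size_1addX.
Qed.

Lemma size_wt a b : size (wt a b) = (a + b).+1.
Proof.
have sz p k : size p = 2%N -> size (p ^+ k) = k.+1.
  move=> p2; have p0 : p ^+ k != 0 by rewrite expf_neq0// -size_poly_eq0 p2.
  by rewrite -[LHS]prednK ?size_poly_gt0// size_exp p2 mul1n.
rewrite size_mul ?expf_neq0 -?size_poly_eq0 ?size_1subX ?size_1addX//.
by rewrite !sz ?size_1subX ?size_1addX// addSn addnS.
Qed.

Lemma lead_wt a b : lead_coef (wt a b) = (-1) ^+ a.
Proof.
rewrite lead_coefM !lead_coef_exp.
have -> : lead_coef (1 - 'X : {poly R}) = -1.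
  by rewrite -opprB lead_coefN -polyC1 lead_coefXsubC.
have -> : lead_coef (1 + 'X : {poly R}) = 1.
  by rewrite addrC -polyC1 lead_coefXaddC.
by rewrite expr1n mulr1.
Qed.

Lemma wt_horner1 a b : (wt a.+1 b).[1] = 0.
Proof.
by rewrite hornerM exprS hornerM (_ : (1 - 'X).[1] = 0) ?mul0r// !hornerE subrr.
Qed.

Lemma wt_hornerN1 a b : (wt a b.+1).[-1] = 0.
Proof.
by rewrite hornerM exprS hornerM (_ : (1 + 'X).[-1] = 0) ?mul0r ?mulr0// !hornerE subrr.
Qed.

Lemma wt_ge0 a b (x : R) : -1 <= x <= 1 -> 0 <= (wt a b).[x].
Proof.
move=> x1; rewrite /wt !hornerE/=.
by apply: mulr_ge0; apply: exprn_ge0; lra.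
Qed.

Lemma deriv_wt a b q : (wt a.+1 b.+1 * q)^`() =
  wt a b * (- (a.+1%:R *: ((1 + 'X) * q)) + b.+1%:R *: ((1 - 'X) * q)
            + (1 - 'X) * (1 + 'X) * q^`()).
Proof.
have D1 : ((1 - 'X) ^+ a.+1)^`() = - (a.+1%:R%:P * (1 - 'X) ^+ a) :> {poly R}.
  rewrite deriv_exp derivB derivX derivC sub0r mulN1r mulNrn.
  by rewrite polyC_natr mulr_natl.
have D2 : ((1 + 'X) ^+ b.+1)^`() = b.+1%:R%:P * (1 + 'X) ^+ b :> {poly R}.
  by rewrite deriv_exp derivD derivX derivC add0r mul1r polyC_natr mulr_natl.
by rewrite /wt !derivM D1 D2 -!mul_polyC !exprS; ring.
Qed.

(** Each derivative costs one power of 1 - x and one of 1 + x. This makes the division in Rodrigues'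
    formula exact. *)
Lemma derivn_wt n a b q :
  exists r, (wt (a + n) (b + n) * q)^`(n) = wt a b * r.
Proof.
elim: n q => [|n IHn] q; first by exists q; rewrite !addn0 derivn0.
rewrite !addnS derivSn deriv_wt; exact: IHn.
Qed.

Lemma rodrigues n a b : wt a b * J n a b =
  ((-1) ^+ n / (2 ^+ n * (n`!)%:R)) *: (wt (a + n) (b + n))^`(n).
Proof.
rewrite /jacobi -scalerAr; congr (_ *: _); rewrite mulrC divpK//.
have [r] := derivn_wt n a b 1; rewrite mulr1 => ->.
exact: dvdp_mulIl.
Qed.

(** By parts [n] times: each boundary term still contains a factor (1 - x)(1 + x), and the [n]-th
    derivative of [q] is 0. *)
Lemma integ_derivn_wt n a b q : (size q <= n)%N ->
  integ ((wt (a + n) (b + n))^`(n) * q) = 0.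
Proof.
elim: n a b q => [|n IHn] a b q sq.
  by move: sq; rewrite leqn0 size_poly_eq0 => /eqP->; rewrite mulr0 raddf0.
rewrite derivnS integ_by_parts.
have [r] := derivn_wt n a.+1 b.+1 1; rewrite !addSnnS mulr1 => E.
rewrite E -mulrA ![(wt a.+1 b.+1 * _).[_]]hornerM wt_horner1 wt_hornerN1 -E.
rewrite !mul0r -!addSnnS IHn ?subrr//.
have [->|q0] := eqVneq q 0; first by rewrite deriv0 size_poly0.
by rewrite -ltnS (leq_trans (lt_size_deriv q0)).
Qed.

Lemma jacobi_orth n a b q : (size q <= n)%N -> integ (wt a b * J n a b * q) = 0.
Proof.
move=> sq.
by rewrite rodrigues -scalerAl linearZ/= integ_derivn_wt// mulr0.
Qed.

(** This is 2^-n times the binomial coefficient of 2n + s over n, with s = a + b. *)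
Definition jacobi_lead n s : R := ((n + n + s) ^_ n)%:R / (2 ^+ n * (n`!)%:R).

Lemma size_lead_jacobi n a b :
  size (J n a b) = n.+1 /\ lead_coef (J n a b) = jacobi_lead n (a + b).
Proof.
set c := (-1) ^+ n / (2 ^+ n * (n`!)%:R) : R.
have c0 : c != 0.
  by rewrite mulf_neq0 ?signr_eq0 ?invr_neq0 ?mulf_neq0 ?expf_neq0 ?pnatr_eq0
    -?lt0n ?fact_gt0.
set W := wt (a + n) (b + n).
have sW : size W = (n + (a + b + n)).+1 by rewrite size_wt; congr _.+1; lia.
have WE : (W^`(n))`_(a + b + n) =
    (-1) ^+ (a + n) * ((n + (a + b + n)) ^_ n)%:R.
  rewrite coef_derivn -(mulr_natr W`_(_)); congr (_ * _).
  by rewrite -(lead_wt _ (b + n)) lead_coefE -/W sW.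
have ff0 : ((n + (a + b + n)) ^_ n)%:R != 0 :> R.
  by rewrite pnatr_eq0 -lt0n ffact_gt0 leq_addr.
have sWn : size W^`(n) = (a + b + n).+1.
  apply/eqP; rewrite eqn_leq; apply/andP; split.
    apply/leq_sizeP => k lt_k; rewrite coef_derivn nth_default ?mul0rn//.
    by rewrite sW ltn_add2l.
  rewrite ltnNge; apply/negP => /leq_sizeP/(_ _ (leqnn _)) /eqP.
  by rewrite WE mulf_eq0 (negPf ff0) orbF signr_eq0.
have JE := rodrigues n a b; rewrite -/c -/W in JE.
move: (J n a b) JE => p JE.
have J0 : p != 0.
  apply/eqP => p0; move: JE; rewrite p0 mulr0 => /esym/eqP.
  by rewrite scaler_eq0 (negPf c0) -size_poly_eq0 sWn.
split.
  have := size_mul (wt_neq0 a b) J0.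
  by rewrite JE (size_scale _ c0) sWn size_wt addSn -addnS => /addnI.
have LW : lead_coef W^`(n) = (-1) ^+ (a + n) * ((n + (a + b + n)) ^_ n)%:R.
  by rewrite lead_coefE sWn.
have := congr1 (fun p : {poly R} => lead_coef p) JE => /=.
rewrite lead_coefM lead_wt lead_coefZ LW.
move=> /(congr1 ( *%R ((-1) ^+ a))); rewrite mulrA -expr2 sqrr_sign mul1r => ->.
rewrite /c exprD /jacobi_lead.
have -> : (n + (a + b + n) = n + n + (a + b))%N by lia.
have sq k : ((-1) ^+ k * (-1) ^+ k : R) = 1 by rewrite -expr2 sqrr_sign.
set F := (_ ^_ n)%:R; set D := 2 ^+ n * _.
transitivity ((-1) ^+ a * (-1) ^+ a * ((-1) ^+ n * (-1) ^+ n) * (F / D)).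
  by ring.
by rewrite !sq !mul1r.
Qed.

Lemma size_jacobi n a b : size (J n a b) = n.+1.
Proof. by have [] := size_lead_jacobi n a b. Qed.

Lemma coef_jacobi n a b : (J n a b)`_n = jacobi_lead n (a + b).
Proof. by have [sJ <-] := size_lead_jacobi n a b; rewrite lead_coefE sJ. Qed.

Lemma integ_wt_sqr_gt0 a b q : q != 0 -> 0 < integ (wt a b * q * q).
Proof.
move=> q0; apply: integ_gt0.
  exact: mulf_neq0 (mulf_neq0 (wt_neq0 a b) q0) q0.
move=> x x1; rewrite -mulrA hornerM; apply: mulr_ge0; rewrite ?wt_ge0//.
by rewrite hornerM -expr2 sqr_ge0.
Qed.

(** The difference of the two sides has degree below [n], hence is orthogonal to itself for a
    positive weight. The differential and contiguity relations below are obtained by checking these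
    hypotheses. *)
Lemma jacobi_unique n a b (l : R) q :
  (size q <= n.+1)%N -> q`_n = l * jacobi_lead n (a + b) ->
  (forall r, (size r <= n)%N -> integ (wt a b * q * r) = 0) ->
  q = l *: J n a b.
Proof.
move=> sq qn orth; apply/eqP; rewrite -subr_eq0; apply/negPn/negP => t0.
set t := q - _ in t0; have st : (size t <= n)%N.
  apply/leq_sizeP => k; rewrite leq_eqVlt => /predU1P[<-|ltk].
    by rewrite coefB coefZ qn coef_jacobi subrr.
  rewrite coefB coefZ !nth_default ?mulr0 ?subrr// ?size_jacobi//.
  exact: leq_trans ltk.
have E : wt a b * t * t = wt a b * q * t - l *: (wt a b * J n a b * t).
  by rewrite /t -!mul_polyC; ring.
have := integ_wt_sqr_gt0 a b t0.
by rewrite E raddfB/= orth// linearZ/= jacobi_orth// mulr0 subrr ltxx.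
Qed.

End JacobiPolynomials.

(** * Differential relations and endpoint values of Jacobi polynomials *)

Section JacobiIdentities.
Variable R : realType.
Implicit Types (p q r : {poly R}) (a b n : nat).

Local Notation J n a b := (jacobi R n a b).

Lemma size_deriv_le n p : (size p <= n.+1)%N -> (size p^`() <= n)%N.
Proof.
have [->|p0] := eqVneq p 0; first by rewrite deriv0 size_poly0.
by move=> sp; rewrite -ltnS (leq_trans (lt_size_deriv p0)).
Qed.

Lemma size_1subXM n p : (size p <= n)%N -> (size ((1 - 'X) * p)%R <= n.+1)%N.
Proof.
by move=> sp; rewrite (leq_trans (size_polyMleq _ _))// size_1subX.
Qed.

Lemma size_1addXM n p : (size p <= n)%N -> (size ((1 + 'X) * p)%R <= n.+1)%N.
Proof.
by move=> sp; rewrite (leq_trans (size_polyMleq _ _))// size_1addX.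
Qed.

Lemma size_polyD_le n p q :
  (size p <= n)%N -> (size q <= n)%N -> (size (p + q)%R <= n)%N.
Proof. by move=> sp sq; rewrite (leq_trans (size_polyD _ _))// geq_max sp. Qed.

Lemma coef_1subXM n p : ((1 - 'X) * p)`_n = p`_n - (if n is m.+1 then p`_m else 0).
Proof. by rewrite mulrBl mul1r coefB coefXM; case: n. Qed.

Lemma integ_wt_deriv a b p q : integ (wt R a.+1 b.+1 * p^`() * q) =
  - integ (p * (wt R a.+1 b.+1 * q)^`()).
Proof.
rewrite mulrAC mulrC integ_by_parts.
have -> : p * (wt R a.+1 b.+1 * q) = wt R a.+1 b.+1 * (p * q) by rewrite mulrCA.
rewrite ![(wt R a.+1 b.+1 * _).[_]]hornerM wt_horner1 wt_hornerN1.
by rewrite !mul0r subrr sub0r.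
Qed.

(** The derivative is (1 - 'X)^a times a cofactor [q]. That [q] is orthogonal for the weight (1 -
    x)^a (1 + x) follows by parts: the weight supplies a factor vanishing at -1, the power of 1 - x
    one vanishing at 1. *)
Lemma deriv_wt_jacobi n a : ((1 - 'X) ^+ a.+1 * J n a.+1 0)^`() =
  - (a.+1 + n)%:R *: ((1 - 'X) ^+ a * J n a 1).
Proof.
set q := - a.+1%:R *: J n a.+1 0 + (1 - 'X) * (J n a.+1 0)^`().
have D1 : ((1 - 'X) ^+ a.+1)^`() = - (a.+1%:R%:P * (1 - 'X) ^+ a) :> {poly R}.
  rewrite deriv_exp derivB derivX derivC sub0r mulN1r mulNrn.
  by rewrite polyC_natr mulr_natl.
have dE : ((1 - 'X) ^+ a.+1 * J n a.+1 0)^`() = (1 - 'X) ^+ a * q.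
  by rewrite derivM D1 /q -mul_polyC polyCN exprS; ring.
rewrite dE scalerAr; congr (_ * _).
have sJ' : (size (J n a.+1 0)^`() <= n)%N.
  by rewrite size_deriv_le ?size_jacobi.
apply: jacobi_unique.
- by rewrite size_polyD_le ?size_1subXM// (leq_trans (size_scale_leq _ _)) ?size_jacobi.
- rewrite coefD coefZ coef_1subXM !coef_deriv coef_jacobi addn0 addn1.
  rewrite [(J _ _ _)`_n.+1]nth_default ?size_jacobi// mul0rn sub0r.
  case: n @q dE sJ' => [|n] _ _ _; first by rewrite addn0; ring.
  by rewrite coef_deriv coef_jacobi addn0 -mulr_natr natrD; ring.
- move=> r sr; rewrite /wt expr1.
  have -> : (1 - 'X) ^+ a * (1 + 'X) * q * r =
      ((1 - 'X) ^+ a.+1 * J n a.+1 0)^`() * ((1 + 'X) * r) by rewrite dE; ring.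
  rewrite integ_by_parts.
  have -> : (1 - 'X) ^+ a.+1 * J n a.+1 0 * ((1 + 'X) * r) =
      wt R a.+1 1 * (J n a.+1 0 * r) by rewrite /wt expr1; ring.
  rewrite ![(wt _ _ _ * _).[_]]hornerM wt_horner1 wt_hornerN1 !mul0r subrr sub0r.
  have -> : (1 - 'X) ^+ a.+1 * J n a.+1 0 = wt R a.+1 0 * J n a.+1 0.
    by rewrite /wt expr0 mulr1.
  by rewrite jacobi_orth ?oppr0// size_deriv_le// size_1addXM.
Qed.

Lemma natr2_neq0 n : (2 ^+ n * (n`!)%:R : R) != 0.
Proof.
by rewrite mulf_neq0 ?expf_neq0 ?pnatr_eq0 -?lt0n ?fact_gt0.
Qed.

Lemma deriv_jacobi n a b : (J n.+1 a b)^`() =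
  ((n + a + b + 2)%:R / 2) *: J n a.+1 b.+1.
Proof.
apply: jacobi_unique.
- by rewrite size_deriv_le ?size_jacobi.
- rewrite coef_deriv coef_jacobi /jacobi_lead.
  have -> : (n.+1 + n.+1 + (a + b) = n + n + (a.+1 + b.+1))%N by lia.
  rewrite ffactnSr factS exprS.
  have -> : (n + n + (a.+1 + b.+1) - n = n + a + b + 2)%N by lia.
  have := natr2_neq0 n; rewrite mulf_eq0 => /norP[h1 h2].
  have h3 : n.+1%:R != 0 :> R by rewrite pnatr_eq0.
  rewrite -mulr_natr !natrM; set N := (_ + 2)%:R; set F := (_ ^_ n)%:R.
  field; exact/and3P.
- move=> r sr; rewrite integ_wt_deriv deriv_wt mulrC.
  rewrite [_ * J _ _ _]mulrAC jacobi_orth ?oppr0//.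
  rewrite !size_polyD_le ?size_polyN ?(leq_trans (size_scale_leq _ _))
    ?size_1subXM ?size_1addXM// -mulrA.
  case: n sr => [|n] sr; last by rewrite !(size_1subXM, size_1addXM, size_deriv_le).
  by move: sr; rewrite leqn0 size_poly_eq0 => /eqP->; rewrite deriv0 !mulr0 size_poly0.
Qed.

Lemma derivn_mulXsubC_exp n k q c : exists2 r,
  (q * ('X - c%:P) ^+ (k + n))^`(n) = ('X - c%:P) ^+ k * r &
  r.[c] = ((k + n) ^_ n)%:R * q.[c].
Proof.
elim: n q => [|n IHn] q.
  by exists q; rewrite ?ffactn0 ?mul1r// addn0 derivn0 mulrC.
rewrite addnS derivSn.
have -> : (q * ('X - c%:P) ^+ (k + n).+1)^`() =
    (q^`() * ('X - c%:P) + (k + n).+1%:R *: q) * ('X - c%:P) ^+ (k + n).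
  rewrite derivM deriv_exp derivXsubC mul1r /= exprS -mulr_natl -polyC_natr.
  by rewrite -mul_polyC; ring.
have [r -> rc] := IHn (q^`() * ('X - c%:P) + (k + n).+1%:R *: q).
exists r => //; rewrite rc hornerD hornerM hornerXsubC subrr mulr0 add0r hornerZ.
by rewrite ffactSS natrM; ring.
Qed.

(** Evaluates Rodrigues' formula at an endpoint [c] of [-1, 1] whose parameter is 0: all [n]
    derivatives must fall on the power of ['X - c%:P]. *)
Lemma horner_derivn_root n q c :
  ((q * ('X - c%:P) ^+ n)^`(n)).[c] = (n`!)%:R * q.[c].
Proof.
have [r] := derivn_mulXsubC_exp n 0 q c.
by rewrite add0n expr0 mul1r ffactnn => ->.
Qed.

Lemma jacobi_hornerN1 n a : (J n a 0).[-1] = (-1) ^+ n.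
Proof.
move: (J n a 0) (rodrigues R n a 0) => p /(congr1 (fun q => q.[-1])).
rewrite hornerZ add0n /wt expr0 mulr1 hornerM.
have -> : 1 + 'X = 'X - (-1)%:P :> {poly R} by rewrite polyCN opprK addrC.
rewrite horner_derivn_root !horner_exp hornerD hornerN hornerX hornerC opprK.
have := natr2_neq0 n; rewrite mulf_eq0 => /norP[h1 h2].
have h3 : (1 + 1) ^+ a != 0 :> R by rewrite expf_neq0// pnatr_eq0.
move=> e; apply: (mulfI h3); rewrite e exprD; field.
exact/andP.
Qed.

Lemma legendre_horner1 n : (legendre R n).[1] = 1.
Proof.
rewrite /legendre.
move: (J n 0 0) (rodrigues R n 0 0) => p /(congr1 (fun q => q.[1])).
rewrite hornerZ add0n /wt !expr0 mulr1 mul1r => ->.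
have -> : (1 - 'X) ^+ n * (1 + 'X) ^+ n =
    (-1) ^+ n *: (1 + 'X) ^+ n * ('X - 1%:P) ^+ n :> {poly R}.
  have -> : 1 - 'X = (- 1)%:P * ('X - 1%:P) :> {poly R} by rewrite polyCN; ring.
  by rewrite exprMn -polyC_exp -mul_polyC; ring.
rewrite horner_derivn_root hornerZ horner_exp hornerD hornerX hornerC.
have := natr2_neq0 n; rewrite mulf_eq0 => /norP[h1 h2].
have sq : ((-1) ^+ n * (-1) ^+ n : R) = 1 by rewrite -expr2 sqrr_sign.
transitivity ((-1) ^+ n * (-1) ^+ n : R) => //.
field; exact/andP.
Qed.

End JacobiIdentities.

(** The polynomial that agrees with [jacobi_hat] for x >= -1; below -1 [jacobi_hat] is 0, while
    [hat] continues as a polynomial. Locked, so that it stays an atom in computations. *)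
HB.lock Definition hat (R : realType) (n a : nat) : {poly R} :=
  prim (jacobi R n.-1 a 0) - ((prim (jacobi R n.-1 a 0)).[-1])%:P.

(** At z it is [omega_y], and at chi it is [omega / omega_y]: all powers of [omega] and [omega_y]
    are written with it. *)
HB.lock Definition halfX (R : realType) : {poly R} := 2^-1 *: (1 - 'X).

(** * Legendre recursion, integrated Jacobi polynomials and their orthogonality *)

Section JacobiHat.
Variable R : realType.
Implicit Types (p q r : {poly R}) (a b n m : nat).

Local Notation J n a b := (jacobi R n a b).
Local Notation L n := (legendre R n).

Lemma legendre_hornerN1 n : (L n).[-1] = (-1) ^+ n.
Proof. exact: jacobi_hornerN1. Qed.

Lemma legendre_orth n q : (size q <= n)%N -> integ (L n * q) = 0.
Proof.
by move=> sq; rewrite -(jacobi_orth 0 0 sq) /wt !expr0 !mul1r.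
Qed.

(** Expresses the P_(i-1)^(1,1) occurring in [bI_aux] through L_(i-1) and its derivative. In the
    orthogonality check the boundary terms of the two integrations by parts cancel, by L_n(1) = 1
    and L_n(-1) = (-1)^n. *)
Lemma legendre_deriv_rec n :
  (L n.+1)^`() - 'X * (L n)^`() = n.+1%:R *: L n.
Proof.
have sX p k : (size p <= k)%N -> (size ('X * p)%R <= k.+1)%N.
  by move=> sp; rewrite (leq_trans (size_polyMleq _ _))// size_polyX.
apply: jacobi_unique.
- rewrite size_polyD_le// ?size_polyN ?sX// size_deriv_le ?size_jacobi//.
- have ffactE : ((n.+1 + n.+1) ^_ n.+1 = 2 * (2 * n + 1) * (n + n) ^_ n)%N.
    have e : ((n + n).+1 ^_ n * n.+1 = (n + n).+1 * (n + n) ^_ n)%N.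
      by rewrite -ffactSS ffactnSr; congr (_ * _)%N; lia.
    have -> : (n.+1 + n.+1 = (n + n).+2)%N by lia.
    rewrite ffactSS; apply/eqP; rewrite -(eqn_pmul2r (ltn0Sn n)) -mulnA e.
    by move: (_ ^_ n)%N => F; apply/eqP; nia.
  rewrite coefB coefXM !coef_deriv !coef_jacobi /jacobi_lead !addn0 ffactE.
  have h := natr2_neq0 R n; have := h; rewrite mulf_eq0 => /norP[h1 h2].
  have h3 : n.+1%:R != 0 :> R by rewrite pnatr_eq0.
  have -> : (if n == 0%N then 0 else (L n)`_n.-1.+1 *+ n.-1.+1) =
      n%:R * (L n)`_n.
    by case: n {ffactE h h1 h2 h3} => [|k]; rewrite ?mul0r//= mulr_natl.
  rewrite coef_jacobi addn0 /jacobi_lead addn0 -mulr_natr factS exprS !natrM natrD.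
  set F := (_ ^_ n)%:R; rewrite natrM -natr1.
  field; rewrite natr1; exact/and3P.
- move=> r sr; rewrite /wt !expr0 !mul1r mulrBl raddfB/=.
  rewrite integ_by_parts legendre_orth; last by rewrite ltnW// ltnS size_deriv_le// ltnW.
  rewrite ['X * _]mulrC -mulrA integ_by_parts legendre_orth; last first.
    by rewrite size_deriv_le// sX.
  rewrite !hornerM !hornerX !legendre_horner1 !legendre_hornerN1 exprS; ring.
Qed.

(** Turns the component of [b1I_aux] along z, at fixed eta and chi, into a multiple of the single
    polynomial P_j^(1,0)(chi). *)
Lemma jacobi21_add_jacobi11 n :
  2^-1 *: ((1 - 'X) * J n 2 1) + J n.+1 1 1 = J n.+1 1 0.
Proof.
rewrite -[RHS]scale1r; apply: jacobi_unique.
- apply: size_polyD_le; last by rewrite size_jacobi.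
  by rewrite (leq_trans (size_scale_leq _ _))// size_1subXM ?size_jacobi.
- rewrite coefD coefZ coef_1subXM !coef_jacobi nth_default ?size_jacobi// sub0r.
  rewrite mul1r /jacobi_lead.
  have -> : (n.+1 + n.+1 + (1 + 1) = (n + n + (2 + 1)).+1)%N by lia.
  have -> : (n.+1 + n.+1 + (1 + 0) = n + n + (2 + 1))%N by lia.
  rewrite ffactSS ffactnSr.
  have -> : (n + n + (2 + 1) - n = n + 3)%N by lia.
  have := natr2_neq0 R n; rewrite mulf_eq0 => /norP[h1 h2].
  have h3 : n.+1%:R != 0 :> R by rewrite pnatr_eq0.
  have -> : (n + n + (2 + 1)).+1 = (n + n + 4)%N by lia.
  rewrite factS exprS !natrM; set F := (_ ^_ n)%:R; rewrite !natrD -natr1.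
  field; rewrite natr1; exact/and3P.
- (* Writing r = r(-1) + (1 + X) s, both terms kill the second part, and the
     integrals of the two terms against 1 - X cancel. *)
  move=> r sr; rewrite /wt expr0 expr1 mulr1.
  have [s rE] : exists s, r = r.[-1]%:P + (1 + 'X) * s.
    have /factor_theorem[s sE] : root (r - r.[-1]%:P) (-1).
      by apply/rootP; rewrite !hornerE subrr.
    exists s; rewrite [_ * s]mulrC -polyC1 -[1%:P]opprK -polyCN -addrC.
    by rewrite [X in s * X]addrC -sE; ring.
  have ss : (size s <= n)%N.
    have [->|s0] := eqVneq s 0; first by rewrite size_poly0.
    have : (size ((1 + 'X) * s)%R <= n.+1)%N.
      have -> : (1 + 'X) * s = r - r.[-1]%:P by rewrite {1}rE; ring.
      by rewrite size_polyD_le ?size_polyN// (leq_trans (size_polyC_leq1 _)).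
    by rewrite size_mul -?size_poly_eq0 ?size_1addX ?size_poly_eq0.
  (* Integrate [deriv_wt_jacobi]: the power of 1 - x vanishes at 1, so only the endpoint -1
     contributes, where the Jacobi polynomial is (-1)^k. *)
  have key k a : integ ((1 - 'X) ^+ a.+1 * J k a.+1 1) =
      (2 ^+ a.+2 / (a.+2 + k)%:R) * (-1) ^+ k :> R.
    have /(congr1 (fun p => integ p)) := deriv_wt_jacobi R k a.+1.
    have E x : ((1 - 'X) ^+ a.+2 * J k a.+2 0).[x] =
        (1 - x) ^+ a.+2 * (J k a.+2 0).[x].
      by rewrite hornerM horner_exp hornerD hornerN hornerX hornerC.
    rewrite linearZ integ_deriv !E jacobi_hornerN1 subrr expr0n mul0r opprK => e.
    have h : (a.+2 + k)%:R != 0 :> R by rewrite pnatr_eq0.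
    by apply: (mulfI h); rewrite -[LHS]opprK -mulNr -[X in - X]e; field.
  set q := _ + J n.+1 1 1.
  have -> : (1 - 'X) * q * r =
      2^-1 *: (wt R 2 1 * J n 2 1 * s) + wt R 1 1 * J n.+1 1 1 * s
      + ((r.[-1] / 2) *: ((1 - 'X) ^+ 2 * J n 2 1)
         + r.[-1] *: ((1 - 'X) ^+ 1 * J n.+1 1 1)).
    by rewrite {1}rE /q /wt -!mul_polyC polyCM; ring.
  rewrite !raddfD/= !linearZ/= !jacobi_orth ?(leq_trans ss)//.
  rewrite !key (_ : (3 + n = 2 + n.+1)%N)// [(-1) ^+ n.+1]exprS.
  have h : (2 + n.+1)%:R != 0 :> R by rewrite pnatr_eq0.
  by field.
Qed.

Lemma deriv_hat n a : (hat R n a)^`() = J n.-1 a 0.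
Proof. by rewrite hat.unlock derivB derivC subr0 deriv_prim. Qed.

Lemma hat_hornerN1 n a : (hat R n a).[-1] = 0.
Proof. by rewrite hat.unlock !hornerE subrr. Qed.

Lemma hat_horner1 n : (1 < n)%N -> (hat R n 0).[1] = 0.
Proof.
case: n => [|[|n]]// _; rewrite hat.unlock hornerD hornerN hornerC -/(integ _).
by rewrite -[X in integ X]mulr1 legendre_orth// size_poly1.
Qed.

Lemma deriv_halfX n a : (halfX R ^+ a.+1 * J n a.+1 0)^`() =
  - ((a.+1 + n)%:R / 2) *: (halfX R ^+ a * J n a 1).
Proof.
rewrite halfX.unlock !exprZn -!scalerAl derivZ deriv_wt_jacobi !scalerA.
by congr (_ *: _); rewrite exprS; ring.
Qed.

Definition nrm n a : R := integ (halfX R ^+ a * J n a 0 * J n a 0).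

Lemma nrm_neq0 n a : nrm n a != 0.
Proof.
rewrite /nrm halfX.unlock exprZn -!scalerAl linearZ/=; apply: mulf_neq0.
  by rewrite expf_neq0// invr_eq0 pnatr_eq0.
have -> : (1 - 'X) ^+ a = wt R a 0 by rewrite /wt expr0 mulr1.
by rewrite gt_eqF// integ_wt_sqr_gt0// -size_poly_eq0 size_jacobi.
Qed.

Lemma integ_jacobi n m a :
  integ (halfX R ^+ a * J n a 0 * J m a 0) = (n == m)%:R * nrm n a.
Proof.
have [->|nm] := eqVneq n m; first by rewrite mul1r.
rewrite mul0r halfX.unlock exprZn -!scalerAl linearZ/=.
have -> : (1 - 'X) ^+ a = wt R a 0 by rewrite /wt expr0 mulr1.
have [lt|lt|/eqP] := ltngtP m n; last by rewrite eq_sym (negPf nm).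
  by rewrite jacobi_orth ?mulr0// size_jacobi.
by rewrite mulrAC jacobi_orth ?mulr0// size_jacobi.
Qed.

(** One integration by parts without boundary terms: the power of [halfX] vanishes at 1 and [hat] at
    -1. It turns P^(a,1) against [hat] into P^(a+1,0) against P^(a+1,0). *)
Lemma integ_jacobi1_hat n m a :
  (a.+1 + n)%:R * integ (halfX R ^+ a * J n a 1 * hat R m.+1 a.+1) =
  2 * ((n == m)%:R * nrm n a.+1).
Proof.
have := integ_by_parts (halfX R ^+ a.+1 * J n a.+1 0) (hat R m.+1 a.+1).
rewrite deriv_halfX deriv_hat/= integ_jacobi !(hornerM _ (hat _ _ _)).
rewrite hat_hornerN1 mulr0 subr0 hornerM horner_exp halfX.unlock hornerZ.
rewrite hornerD hornerN hornerX hornerC subrr mulr0 expr0n !mul0r sub0r.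
rewrite -scalerAl linearZ/= => e.
by move: e; set N := _%:R; set I := integ _; set D := _ * nrm _ _; lra.
Qed.

End JacobiHat.

(** * The bilinear form in the variables chi and z *)

Section BivariateIntegral.
Variable R : realType.
Local Notation Q := {poly {poly R}}.
Local Notation X2 := (halfX R).

(** The weight is the z part of the Jacobian [omega * omega_y]. *)
Definition zint (c : {poly R}) : R := integ (X2 ^+ 2 * c).

Fact zint_is_linear : scalar zint.
Proof. by move=> a p q; rewrite /zint mulrDr -scalerAr linearP. Qed.

HB.instance Definition _ :=
  GRing.isLinear.Build R {poly R} R *%R zint zint_is_linear.

(* Integral over [-1, 1]^2 against (1 - x) / 2 * ((1 - y) / 2)^2, where the
   outer variable of the bivariate polynomial is x and the inner one is y. *)
Definition int2 (K : Q) : R := integ (X2 * map_poly zint K).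

Fact int2_is_additive : additive int2.
Proof. by move=> p q; rewrite /int2 raddfB mulrBr raddfB. Qed.

HB.instance Definition _ := GRing.isZmodMorphism.Build Q R int2 int2_is_additive.

Lemma int2_tensor (B C : {poly R}) :
  int2 (B^:P * C%:P) = integ (X2 * B) * integ (X2 ^+ 2 * C).
Proof.
rewrite /int2 [map_poly _ _](_ : _ = zint C *: B).
  by rewrite -scalerAr linearZ/= mulrC.
apply/polyP => i; rewrite coef_map coefMC coef_map coefZ /=.
by rewrite mul_polyC linearZ/= mulrC.
Qed.

Lemma int2Z (c : R) K : int2 (c%:P%:P * K) = c * int2 K.
Proof.
rewrite /int2 [map_poly _ (_ * _)](_ : _ = c *: map_poly zint K).
  by rewrite -scalerAr linearZ.
by apply/polyP => i; rewrite coef_map coefCM coefZ coef_map/= mul_polyC linearZ.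
Qed.

Lemma integMZ (c : R) p q : integ (p * (c *: q)) = c * integ (p * q).
Proof. by rewrite -scalerAr linearZ. Qed.

(** The 2 is what the eta integral of hat L_i against -2 times a Legendre derivative leaves after
    integration by parts. *)
Definition form (e d : Q * Q * Q) : Q :=
  2 * e.1.1 * d.1.1 + e.1.2 * d.1.2 + e.2 * d.2.

Definition gram e d : R := int2 (form e d).

Definition sc (c : R) (e : Q * Q * Q) : Q * Q * Q :=
  (c%:P%:P * e.1.1, c%:P%:P * e.1.2, c%:P%:P * e.2).

Lemma gramDl e e' d : gram (e + e') d = gram e d + gram e' d.
Proof. by rewrite /gram -raddfD; congr int2; rewrite /form/=; ring. Qed.

Lemma gramDr e d d' : gram e (d + d') = gram e d + gram e d'.
Proof. by rewrite /gram -raddfD; congr int2; rewrite /form/=; ring. Qed.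

Lemma gramZl c e d : gram (sc c e) d = c * gram e d.
Proof. by rewrite /gram -int2Z; congr int2; rewrite /form/=; ring. Qed.

Lemma gramZr c e d : gram e (sc c d) = c * gram e d.
Proof. by rewrite /gram -int2Z; congr int2; rewrite /form/=; ring. Qed.

End BivariateIntegral.

(** * Coefficient triples of the elementary fields and their mutual pairings *)

Section Elementary.
Variable R : realType.
Local Notation Q := {poly {poly R}}.
Local Notation X2 := (halfX R).
Local Notation J n a b := (jacobi R n a b).
Local Notation u := (X2^:P : Q).
Local Notation v := (X2%:P : Q).
Local Notation G m a := ((hat R m a)^:P : Q).
Local Notation H m a := ((hat R m a)%:P : Q).
Local Notation P n a b := ((J n a b)^:P : Q).
Local Notation S n a b := ((J n a b)%:P : Q).
Local Notation K c := ((c : R)%:P%:P : Q).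
Implicit Types n m l : nat.

Section Indices.
Variables n m l : nat.
Local Notation a := (2 * n.+2)%N.
Local Notation b := (2 * n.+2 + 2 * m.+1)%N.

(** Here n, m, l are i - 2, j - 1, k - 1. [prA], [prB], [prC] hold the (eta, chi, z)-components of f
    grad g x grad h, g grad h x grad f, h grad f x grad g with the factor in eta split off; [duA],
    [duB], [duC] belong in the same way to [bI_aux], [bII_aux], [bIII_aux]. *)
Definition prA : Q * Q * Q :=
  (u ^+ n.+1 * v ^+ (n + m).+1 * P m a 0 * S l b 0, 0, 0).

Definition prB : Q * Q * Q :=
  (K (n.+2%:R / 2) * u ^+ n * v ^+ (n + m).+1 * G m.+1 a * S l b 0,
   u ^+ n.+1 * v ^+ (n + m).+1 * G m.+1 a * S l b 0, 0).

Definition prC : Q * Q * Q :=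
  (K (n.+2%:R * m.+1%:R / 4) * u ^+ n * v ^+ (n + m) * G m.+1 a * H l.+1 b
   + K (n.+2%:R / 2) * u ^+ n.+1 * v ^+ (n + m) * P m a 0 * H l.+1 b,
   K (m.+1%:R / 2) * u ^+ n.+1 * v ^+ (n + m) * G m.+1 a * H l.+1 b,
   u ^+ n.+1 * v ^+ (n + m).+1 * P m a 0 * H l.+1 b).

Definition duA : Q * Q * Q :=
  (u ^+ n.+2 * v ^+ (n + m).+3 * P m a 0 * S l b 0,
   - K n.+2%:R * u ^+ n.+1 * v ^+ (n + m).+3 * P m a 0 * S l b 0,
   - K n.+2%:R * u ^+ n.+2 * v ^+ (n + m).+2 * P m a 0 * S l b 0).

Definition duB : Q * Q * Q :=
  (0,
   K (2 * n.+2%:R + m.+1%:R - 1) * u ^+ n.+1 * v ^+ (n + m).+3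
     * P m (a - 1) 1 * S l b 0,
   - K m.+1%:R * u ^+ n.+2 * v ^+ (n + m).+2 * P m a 0 * S l b 0).

Definition duC : Q * Q * Q :=
  (0, 0,
   K (2 * n.+2%:R + 2 * m.+1%:R + l.+1%:R - 1) * u ^+ n.+2 * v ^+ (n + m).+2
     * P m a 0 * S l (b - 1) 1).

(** The common value of the three diagonal pairings. *)
Definition kap : R := 2 * nrm R m a * nrm R l b.

Lemma kap_neq0 : kap != 0.
Proof. by rewrite !mulf_neq0 ?nrm_neq0// pnatr_eq0. Qed.

End Indices.

Section Indices1.
Variables m l : nat.
Local Notation b := (2 * m.+1 + 3)%N.

(** With v = [vN0], [pr1A] belongs to g (grad h x v) and [pr1B] to h curl(g v). As v is - omega^2 /
    2 times grad eta, neither has a component along eta. *)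
Definition pr1A : Q * Q * Q :=
  (0, K (- (1 / 2)) * u * v ^+ m.+1 * G m.+1 3 * S l b 0, 0).

Definition pr1B : Q * Q * Q :=
  (0, K ((m.+1%:R + 2) / 4) * u * v ^+ m * G m.+1 3 * H l.+1 b,
   K (1 / 2) * v ^+ m.+1 * H l.+1 b * (u * P m 3 0 - G m.+1 3)).

Definition du1A : Q * Q * Q :=
  (0, K (m.+1%:R + 2) * v ^+ m.+2 * P m 2 1 * S l b 0,
   K (m.+1%:R + 2) * v ^+ m.+1 * P m.+1 1 0 * S l b 0).

Definition du1B : Q * Q * Q :=
  (0, 0, K (2 * m.+1%:R + l.+1%:R + 2) * v ^+ m.+1 * P m.+1 1 0
    * S l (2 * m.+1 + 2) 1).

Definition kap1 : R := nrm R m 3 * nrm R l b.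

Lemma kap1_neq0 : kap1 != 0.
Proof. by rewrite !mulf_neq0 ?nrm_neq0. Qed.

End Indices1.

(** [4 *: wF1] is - [omega_y] times the derivative of (x, y, z) with respect to z at fixed eta and
    chi. *)
Definition pr10 l : Q * Q * Q := (0, 0, - v * H l.+1 4).
Definition du10 l : Q * Q * Q := (0, 0, S l 3 1).

Lemma chi_orth m m' a : integ (X2 * (X2 ^+ a * J m a.+1 0 * J m' a.+1 0)) =
  (m == m')%:R * nrm R m a.+1.
Proof. by rewrite -integ_jacobi exprS; congr integ; ring. Qed.

Lemma z_orth l l' a : integ (X2 ^+ 2 * (X2 ^+ a * J l a.+2 0 * J l' a.+2 0)) =
  (l == l')%:R * nrm R l a.+2.
Proof. by rewrite -integ_jacobi !exprS; congr integ; ring. Qed.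

Lemma chi_hat m m' a : (a.+2 + m')%:R *
  integ (X2 * (X2 ^+ a * J m' a.+1 1 * hat R m.+1 a.+2)) =
  2 * ((m == m')%:R * nrm R m a.+2).
Proof.
rewrite [m == m']eq_sym.
have -> : (m' == m)%:R * nrm R m a.+2 = (m' == m)%:R * nrm R m' a.+2.
  by have [->|] := eqVneq m' m; rewrite ?mul0r.
by rewrite -integ_jacobi1_hat exprS; congr (_ * integ _); ring.
Qed.

Lemma z_hat l l' a : (a.+3 + l')%:R *
  integ (X2 ^+ 2 * (X2 ^+ a * J l' a.+2 1 * hat R l.+1 a.+3)) =
  2 * ((l == l')%:R * nrm R l a.+3).
Proof. by rewrite -chi_hat !exprS; congr (_ * integ _); ring. Qed.

Lemma polyC2_half (c : R) : K c = 2 * K (c / 2).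
Proof.
have -> : 2 = K 2 by rewrite !polyC_natr.
by rewrite -!polyCM; do 2 congr polyC; field.
Qed.

Lemma gram_tensor e d (B C : {poly R}) : form e d = B^:P * C%:P ->
  gram e d = integ (X2 * B) * integ (X2 ^+ 2 * C).
Proof. by rewrite /gram => ->; rewrite int2_tensor. Qed.

Lemma gram_form0 (e d : Q * Q * Q) : form e d = 0 -> gram e d = 0.
Proof. by rewrite /gram => ->; rewrite raddf0. Qed.

Section Gram.
Variables n m l m' l' : nat.
Local Notation a := (2 * n.+2)%N.
Local Notation b := (2 * n.+2 + 2 * m.+1)%N.
Local Notation b' := (2 * n.+2 + 2 * m'.+1)%N.
Local Notation delta := (((m == m') && (l == l'))%:R : R).

Lemma gramAA : gram (prA n m l) (duA n m' l') = delta * kap n m l.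
Proof.
rewrite (@gram_tensor _ _ (X2 ^+ (n.+1 + n.+2) * J m a 0 * J m' a 0)
  (2 *: (X2 ^+ ((n + m).+1 + (n + m').+3) * J l b 0 * J l' b' 0))); last first.
  by rewrite /form /prA /duA/= -mul_polyC !(rmorphXn, rmorphM)/= !exprD; ring.
have ea : a = (n.+1 + n.+2).+1 by lia.
(* The exponents of [X2] in the z factor match the parameter [b] only for m = m'; otherwise the chi
   factor is already 0. *)
rewrite {1 2}ea chi_orth -ea; have [<-|_] := eqVneq m m'; last by rewrite !mul0r.
have eb : b = ((n + m).+1 + (n + m).+3).+2 by lia.
rewrite integMZ {1 2}eb z_orth -eb /kap/=; ring.
Qed.

Lemma gramAB : gram (prA n m l) (duB n m' l') = 0.
Proof. by apply: gram_form0; rewrite /form/=; ring. Qed.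

Lemma gramAC : gram (prA n m l) (duC n m' l') = 0.
Proof. by apply: gram_form0; rewrite /form/=; ring. Qed.

(** The eta and chi terms of the integrand cancel identically. *)
Lemma gramBA : gram (prB n m l) (duA n m' l') = 0.
Proof.
apply: gram_form0; rewrite /form /prB /duA/= !exprS.
have -> : K n.+2%:R = 2 * K (n.+2%:R / 2).
  exact: polyC2_half.
ring.
Qed.

Lemma gramBB : gram (prB n m l) (duB n m' l') = delta * kap n m l.
Proof.
rewrite (@gram_tensor _ _ (X2 ^+ (n.+1 + n.+1) * J m' (a - 1) 1 * hat R m.+1 a)
  ((2 * n.+2%:R + m'.+1%:R - 1) *:
    (X2 ^+ ((n + m).+1 + (n + m').+3) * J l b 0 * J l' b' 0))); last first.
  by rewrite /form /prB /duB/= -mul_polyC !(rmorphXn, rmorphM)/= !exprD; ring.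
have := chi_hat m m' (n.+1 + n.+1).
have -> : (n.+1 + n.+1).+2 = a by lia.
have -> : (n.+1 + n.+1).+1 = (a - 1)%N by lia.
have -> : (a + m')%:R = 2 * n.+2%:R + m'.+1%:R - 1 :> R.
  by rewrite natrD natrM -[m'.+1%:R]natr1; ring.
move=> e; rewrite integMZ mulrCA mulrA e.
have [<-|_] := eqVneq m m'; last by rewrite !(mul0r, mulr0).
have eb : b = ((n + m).+1 + (n + m).+3).+2 by lia.
rewrite {1 2}eb z_orth -eb /kap/=; ring.
Qed.

Lemma gramBC : gram (prB n m l) (duC n m' l') = 0.
Proof. by apply: gram_form0; rewrite /form/=; ring. Qed.

Lemma gramCA : gram (prC n m l) (duA n m' l') = 0.
Proof.
apply: gram_form0; rewrite /form /prC /duA/= !exprS.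
have -> : K (n.+2%:R * m.+1%:R / 4) = K (n.+2%:R / 2) * K (m.+1%:R / 2).
  by rewrite -!polyCM; do 2 congr polyC; field.
have -> : K n.+2%:R = 2 * K (n.+2%:R / 2).
  exact: polyC2_half.
ring.
Qed.

(** Here the integrand itself does not vanish. Its chi and z terms share the factor in z, and their
    chi integrals cancel: both are 0 for m <> m', and both are (m + 1) times the same norm for m =
    m'. *)
Lemma gramCB : gram (prC n m l) (duB n m' l') = 0.
Proof.
set c := 2 * n.+2%:R + m'.+1%:R - 1 : R.
rewrite (@gram_tensor _ _
  ((m.+1%:R / 2 * c) *: (X2 ^+ (n.+1 + n.+1) * J m' (a - 1) 1 * hat R m.+1 a)
   - m'.+1%:R *: (X2 ^+ (n.+1 + n.+2) * J m a 0 * J m' a 0))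
  (X2 ^+ ((n + m) + (n + m').+3) * hat R l.+1 b * J l' b' 0)); last first.
  rewrite /form /prC /duB/= -/c; move: c (hat R m.+1 a) (hat R l.+1 b) => c g h.
  rewrite -!mul_polyC !(rmorphB, rmorphM, rmorphXn)/= !map_polyC/=.
  by rewrite !(exprS, exprD); ring.
rewrite (mulrBr X2) raddfB/= (integMZ (_ / 2 * c)) (integMZ m'.+1%:R).
have := chi_hat m m' (n.+1 + n.+1).
have -> : (n.+1 + n.+1).+2 = a by lia.
have -> : (n.+1 + n.+1).+1 = (a - 1)%N by lia.
have -> : (a + m')%:R = c :> R.
  by rewrite /c natrD natrM -[m'.+1%:R]natr1; ring.
move=> e; rewrite -(mulrA (m.+1%:R / 2)). rewrite e; have ea : a = (n.+1 + n.+2).+1 by lia.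
rewrite {2 3}ea chi_orth -ea.
have [<-|_] := eqVneq m m'; last by rewrite !mul0r !mulr0 subrr mul0r.
by rewrite !mul1r [X in X * _ = _](_ : _ = 0) ?mul0r//; field.
Qed.

Lemma gramCC : gram (prC n m l) (duC n m' l') = delta * kap n m l.
Proof.
rewrite (@gram_tensor _ _ (X2 ^+ (n.+1 + n.+2) * J m a 0 * J m' a 0)
  ((2 * n.+2%:R + 2 * m'.+1%:R + l'.+1%:R - 1) *:
    (X2 ^+ ((n + m).+1 + (n + m').+2) * J l' (b' - 1) 1 * hat R l.+1 b)));
  last first.
  by rewrite /form /prC /duC/= -mul_polyC !(rmorphXn, rmorphM)/= !exprD; ring.
have ea : a = (n.+1 + n.+2).+1 by lia.
rewrite {1 2}ea chi_orth -ea; have [<-|_] := eqVneq m m'; last by rewrite !mul0r.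
have := z_hat l l' ((n + m).+1 + (n + m).+2).
have -> : ((n + m).+1 + (n + m).+2).+3 = b by lia.
have -> : ((n + m).+1 + (n + m).+2).+2 = (b - 1)%N by lia.
have -> : (b + l')%:R = 2 * n.+2%:R + 2 * m.+1%:R + l'.+1%:R - 1 :> R.
  by rewrite 2!natrD !natrM -[l'.+1%:R]natr1; ring.
move=> e; rewrite integMZ e /kap/=; ring.
Qed.

End Gram.

Section Gram1.
Variables m l m' l' : nat.
Local Notation b := (2 * m.+1 + 3)%N.
Local Notation b' := (2 * m'.+1 + 3)%N.
Local Notation delta := (((m == m') && (l == l'))%:R : R).

Lemma chi_hat1 : (m'.+1%:R + 2) *
  integ (X2 ^+ 2 * hat R m.+1 3 * J m' 2 1) = 2 * ((m == m')%:R * nrm R m 3).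
Proof.
rewrite -chi_hat (_ : m'.+1%:R + 2 = (3 + m')%:R); last first.
  by rewrite natrD -natr1; ring.
by congr (_ * integ _); ring.
Qed.

(* The first factor is the derivative of X2 ^+ 2 * hat m.+1 3. *)
Lemma chi_deriv q : integ (X2 * (X2 * J m 3 0 - hat R m.+1 3) * q) =
  - integ (X2 ^+ 2 * hat R m.+1 3 * q^`()).
Proof.
have := integ_by_parts (X2 ^+ 2 * hat R m.+1 3) q.
have -> : (X2 ^+ 2 * hat R m.+1 3)^`() = X2 * (X2 * J m 3 0 - hat R m.+1 3).
  rewrite derivM deriv_hat/= expr2 derivM.
  have -> : X2^`() = - (2^-1)%:P.
    by rewrite halfX.unlock derivZ derivB derivX derivC sub0r scalerN alg_polyC.
  by rewrite -[hat _ _ _ in RHS]mul1r -(_ : 2%:P * (2^-1)%:P = 1); [ring|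
    rewrite -polyCM divff ?pnatr_eq0].
move=> ->; rewrite !(hornerM _ q) !(hornerM _ (hat _ _ _)) hat_hornerN1.
rewrite [(X2 ^+ 2).[1]]horner_exp halfX.unlock hornerZ hornerD hornerN hornerX hornerC.
by rewrite subrr mulr0 expr0n/= !mul0r mulr0 mul0r subrr sub0r.
Qed.

Lemma chi_jacobi10 : integ (X2 * (X2 * J m 3 0 - hat R m.+1 3) * J m'.+1 1 0) =
  - ((m == m')%:R * nrm R m 3).
Proof.
rewrite chi_deriv deriv_jacobi integMZ.
have -> : (m' + 1 + 0 + 2)%:R / 2 = (m'.+1%:R + 2) / 2 :> R.
  by rewrite !natrD -natr1; ring.
by congr (- _); rewrite mulrAC chi_hat1; field.
Qed.

Lemma gram1AA : gram (pr1A m l) (du1A m' l') = - (delta * kap1 m l).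
Proof.
rewrite (@gram_tensor _ _ (X2 * hat R m.+1 3 * J m' 2 1)
  ((- (1 / 2) * (m'.+1%:R + 2)) *:
    (X2 ^+ (m.+1 + m'.+2) * J l b 0 * J l' b' 0))); last first.
  by rewrite /form /pr1A /du1A/= -mul_polyC !(rmorphXn, rmorphM)/= !exprD; ring.
rewrite integMZ (_ : X2 * _ = X2 ^+ 2 * hat R m.+1 3 * J m' 2 1); last by ring.
have := chi_hat1; set I := integ (_ * J m' 2 1); set Z := integ (_ * (_ * _)) => e.
transitivity (- (1 / 2) * ((m'.+1%:R + 2) * I) * Z); first by ring.
rewrite e /Z; have [<-|_] := eqVneq m m'; last by rewrite !(mul0r, mulr0) oppr0.
have eb : b = (m.+1 + m.+2).+2 by lia.
by rewrite {1 2}eb z_orth -eb /kap1/=; field.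
Qed.

Lemma gram1AB : gram (pr1A m l) (du1B m' l') = 0.
Proof. by apply: gram_form0; rewrite /form/=; ring. Qed.

Lemma gram1A0 : gram (pr1A m l) (du10 l') = 0.
Proof. by apply: gram_form0; rewrite /form/=; ring. Qed.

(** The same mechanism as in [gramCB]: the chi term, by [chi_hat1], and the z term, by
    [chi_jacobi10], cancel after integration in chi. *)
Lemma gram1BA : gram (pr1B m l) (du1A m' l') = 0.
Proof.
rewrite (@gram_tensor _ _
  (((m.+1%:R + 2) / 4) *: (X2 * hat R m.+1 3 * J m' 2 1)
   + (1 / 2) *: ((X2 * J m 3 0 - hat R m.+1 3) * J m'.+1 1 0))
  ((m'.+1%:R + 2) *: (X2 ^+ (m + m'.+2) * hat R l.+1 b * J l' b' 0))); last first.
  rewrite /form /pr1B /du1A/=; move: (hat R m.+1 3) (hat R l.+1 b) => g h.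
  rewrite -!mul_polyC !(rmorphB, rmorphD, rmorphM, rmorphXn)/= !map_polyC/=.
  by rewrite !(exprS, exprD); ring.
rewrite integMZ (mulrDr X2) raddfD/= (integMZ (_ / 4)) (integMZ (1 / 2)).
rewrite mulrA [X in X * _ = _](_ : _ = 0) ?mul0r//.
rewrite [X2 * (_ * J m' 2 1)](_ : _ = X2 ^+ 2 * hat R m.+1 3 * J m' 2 1);
  last by ring.
rewrite [X2 * (_ * J m'.+1 1 0)]mulrA chi_jacobi10.
have := chi_hat1; set I := integ _ => e.
transitivity ((m.+1%:R + 2) / 4 * ((m'.+1%:R + 2) * I)
  - (1 / 2) * ((m == m')%:R * nrm R m 3) * (m'.+1%:R + 2)); first by ring.
by rewrite e; have [<-|_] := eqVneq m m'; [field | rewrite !(mul0r, mulr0) subrr].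
Qed.

Lemma gram1BB : gram (pr1B m l) (du1B m' l') = - (delta * kap1 m l).
Proof.
rewrite (@gram_tensor _ _ ((X2 * J m 3 0 - hat R m.+1 3) * J m'.+1 1 0)
  ((1 / 2 * (2 * m'.+1%:R + l'.+1%:R + 2)) *:
    (X2 ^+ (m.+1 + m'.+1) * J l' (2 * m'.+1 + 2) 1 * hat R l.+1 b)));
  last first.
  rewrite /form /pr1B /du1B/=; move: (hat R m.+1 3) (hat R l.+1 b) => g h.
  rewrite -!mul_polyC !(rmorphB, rmorphM, rmorphXn)/=.
  by rewrite !(exprS, exprD); ring.
rewrite integMZ [X2 * (_ * J m'.+1 1 0)]mulrA chi_jacobi10.
have [<-|_] := eqVneq m m'; last by rewrite !mul0r oppr0 mul0r.
have := z_hat l l' (m.+1 + m.+1).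
have -> : (m.+1 + m.+1).+3 = b by lia.
have -> : (m.+1 + m.+1).+2 = (2 * m.+1 + 2)%N by lia.
have -> : (b + l')%:R = 2 * m.+1%:R + l'.+1%:R + 2 :> R.
  by rewrite 2!natrD natrM -[l'.+1%:R]natr1; ring.
set I := integ _ => e.
transitivity (- (1 / 2) * nrm R m 3 * ((2 * m.+1%:R + l'.+1%:R + 2) * I)).
  by rewrite /=; ring.
by rewrite e /kap1/=; field.
Qed.

(** Times the weight, the factor in chi is the derivative of a polynomial vanishing at both ends. *)
Lemma gram1B0 : gram (pr1B m l) (du10 l') = 0.
Proof.
rewrite (@gram_tensor _ _ ((X2 * J m 3 0 - hat R m.+1 3) * 1)
  ((1 / 2) *: (X2 ^+ m.+1 * hat R l.+1 b * J l' 3 1))); last first.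
  rewrite /form /pr1B /du10/=; move: (hat R m.+1 3) (hat R l.+1 b) => g h.
  rewrite -!mul_polyC !(rmorphB, rmorphM, rmorphXn)/=.
  by ring.
by rewrite mulrA chi_deriv derivC mulr0 raddf0 oppr0 mul0r.
Qed.

Lemma integ_chi_jacobi10 : integ (X2 * J m'.+1 1 0) = 0.
Proof.
rewrite halfX.unlock -scalerAl linearZ/=.
rewrite (_ : (1 - 'X) * _ = wt R 1 0 * J m'.+1 1 0 * 1); last first.
  by rewrite /wt expr1 expr0; ring.
by rewrite jacobi_orth ?mulr0// size_poly1.
Qed.

Lemma gram01A : gram (pr10 l) (du1A m' l') = 0.
Proof.
rewrite (@gram_tensor _ _ (J m'.+1 1 0)
  (- (m'.+1%:R + 2) *: (X2 ^+ m'.+2 * hat R l.+1 4 * J l' b' 0))); last first.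
  rewrite /form /pr10 /du1A/= -!mul_polyC !(rmorphXn, rmorphM)/= !exprS; ring.
by rewrite integ_chi_jacobi10 mul0r.
Qed.

Lemma gram01B : gram (pr10 l) (du1B m' l') = 0.
Proof.
rewrite (@gram_tensor _ _ (J m'.+1 1 0)
  (- (2 * m'.+1%:R + l'.+1%:R + 2) *:
    (X2 ^+ m'.+2 * hat R l.+1 4 * J l' (2 * m'.+1 + 2) 1))); last first.
  rewrite /form /pr10 /du1B/= -!mul_polyC !(rmorphXn, rmorphM)/= !exprS; ring.
by rewrite integ_chi_jacobi10 mul0r.
Qed.

Definition kap10 (k : nat) : R := - (2 / (4 + k)%:R * integ X2 * nrm R k 4).

Lemma kap10_neq0 k : kap10 k != 0.
Proof.
rewrite oppr_eq0 !mulf_neq0 ?nrm_neq0 ?invr_neq0 ?pnatr_eq0//.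
rewrite halfX.unlock linearZ/= mulf_neq0 ?invr_neq0 ?pnatr_eq0//.
have -> : 1 - 'X = wt R 1 0 * 1 * 1 by rewrite /wt expr1 expr0 !mulr1.
by rewrite gt_eqF// integ_wt_sqr_gt0// oner_eq0.
Qed.

Lemma gram00 : gram (pr10 l) (du10 l') = (l == l')%:R * kap10 l.
Proof.
rewrite (@gram_tensor _ _ 1 ((-1) *: (X2 ^+ 1 * J l' 3 1 * hat R l.+1 4)));
  last first.
  by rewrite /form /pr10 /du10/= -!mul_polyC !rmorphM/= rmorph1 expr1; ring.
rewrite integMZ mulr1; have := z_hat l l' 1.
set I := integ (_ * (_ * _)) => e; have h : (4 + l')%:R != 0 :> R by rewrite pnatr_eq0.
rewrite [I](_ : _ = 2 * ((l == l')%:R * nrm R l 4) / (4 + l')%:R); last first.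
  by apply: (mulfI h); rewrite e; field.
rewrite /kap10; have [<-|_] := eqVneq l l'; last by rewrite !(mul0r, mulr0).
by field.
Qed.

End Gram1.
End Elementary.

(** * Integration over the tetrahedron *)

Section AffineIntegral.
Variable R : realType.
Local Notation mu := (@lebesgue_measure R).
Implicit Types (A B C p q : {poly R}) (c x y z : R).

Lemma integral_deriv_poly q (a b : R) : a <= b ->
  (\int[mu]_(x in `[a, b]) (q^`().[x])%:E = (q.[b] - q.[a])%:E)%E.
Proof.
rewrite le_eqVlt => /predU1P[<-|ab]; first by rewrite set_itv1 integral_set1 subrr.
rewrite (@continuous_FTC2 _ _ (horner q))//.
- exact/continuous_subspaceT/continuous_horner.
- split=> [x _| |]; first exact: derivable_horner.
  + by apply: cvg_at_right_filter; exact: continuous_horner.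
  + by apply: cvg_at_left_filter; exact: continuous_horner.
- by move=> x _; rewrite -derivE.
Qed.

(** The flag keeps or removes the left end, that is, the face on which [jacobi_hat] may fail to be
    differentiable. *)
Definition half (e : bool) c : interval R := Interval (BSide e (- c)) (BRight c).

Lemma integral_half (e : bool) c A : 0 <= c ->
  (\int[mu]_(x in [set` half e c]) (A.[x / c])%:E = (c * integ A)%:E)%E.
Proof.
move=> c0.
have -> : (\int[mu]_(x in [set` half e c]) (A.[x / c])%:E =
    \int[mu]_(x in `[(- c)%R, c]) (A.[x / c])%:E)%E.
  case: e; rewrite /half// integral_itv_obnd_cbnd//.
  apply/measurable_EFinP.
  apply: (measurableT_comp (f := horner A)); first exact: measurable_poly.
  exact: measurable_funM.
move: c0; rewrite le_eqVlt => /predU1P[<-|c0].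
  by rewrite oppr0 set_itv1 integral_set1 mul0r.
pose q := c *: (prim A \Po (c^-1 *: 'X)).
have dq : q^`() = A \Po (c^-1 *: 'X).
  rewrite derivZ deriv_comp deriv_prim derivZ derivX -scalerAr mulr1.
  by rewrite scalerA divff ?scale1r// gt_eqF.
have qE x : q.[x] = c * (prim A).[x / c].
  by rewrite hornerZ horner_comp hornerZ hornerX [x / c]mulrC.
under eq_integral => x _.
  rewrite (_ : A.[x / c] = q^`().[x]); last first.
    by rewrite dq horner_comp hornerZ hornerX [x / c]mulrC.
  over.
rewrite integral_deriv_poly; last by lra.
by rewrite !qE mulNr divff ?gt_eqF// /integ mulrBr.
Qed.

Lemma integral_if (I : interval R) (g : R -> R) :
  (\int[mu]_x (if x \in I then g x else 0)%:E =
   \int[mu]_(x in [set` I]) (g x)%:E)%E.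
Proof.
rewrite [RHS]integral_mkcond; apply: eq_integral => x _.
by rewrite patchE mem_setE; case: ifP.
Qed.

(** Continuous off 0, and 0 is a single point. It makes [eta] and [chi] measurable on the whole
    space, across the zeros of their denominators. *)
Lemma measurable_inv : measurable_fun [set: R]%classic (@GRing.inv R).
Proof.
have -> : [set: R]%classic = (~` [set 0] `|` [set 0])%classic by rewrite setUC setUv.
apply/measurable_funU; [exact: measurableC | by [] | split; last first].
  exact: measurable_fun_set1.
apply: open_continuous_measurable_fun.
  by rewrite openC; exact: closed_eq.
by move=> x; rewrite inE/= => /eqP x0; exact: inv_continuous.
Qed.

Lemma poly_bounded A : exists M, forall x, `|x| <= 1 -> `|A.[x]| <= M.
Proof.
exists (\sum_(i < size A) `|A`_i|) => x x1; rewrite horner_coef.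
apply: (le_trans (ler_norm_sum _ _ _)); apply: ler_sum => i _.
by rewrite normrM normrX ler_piMr// exprn_ile1.
Qed.

End AffineIntegral.

(* HB does not register \x of sigma-finite measures as sigma-finite. *)
Definition lebesgue2 (R : realType) :
    set (measurableTypeR R * measurableTypeR R) -> \bar R :=
  (@lebesgue_measure R \x @lebesgue_measure R)%E.

HB.instance Definition _ (R : realType) := Measure.on (@lebesgue2 R).

Lemma lebesgue2_sigma_finite (R : realType) : sigma_finite setT (@lebesgue2 R).
Proof.
pose I n : set R := `[(- n%:R : R), n%:R]%classic.
exists (fun n => (I n `*` I n)%classic).
  apply/esym; rewrite -subTset => -[x y] _.
  pose n := Num.bound (`|x| + `|y|); exists n => //.
  have := archi_boundP (addr_ge0 (normr_ge0 x) (normr_ge0 y)); rewrite -/n => h.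
  have hx : `|x| <= n%:R by apply: le_trans (ltW h); rewrite lerDl.
  have hy : `|y| <= n%:R by apply: le_trans (ltW h); rewrite lerDr.
  split; rewrite /I/= in_itv/= -ler_norml; [exact: hx|exact: hy].
move=> n; have mI : measurable (I n) by exact: measurable_itv.
split; first exact: measurableX.
have e : lebesgue2 (I n `*` I n)%classic =
    (@lebesgue_measure R (I n) * @lebesgue_measure R (I n))%E.
  exact: product_measure1E.
rewrite e [lebesgue_measure _]lebesgue_measure_itv/=; case: ifP => _; last by rewrite mule0 ltry.
by rewrite -EFinB -EFinM ltry.
Qed.

HB.instance Definition _ (R : realType) :=
  @Measure_isSigmaFinite.Build _ _ _ (@lebesgue2 R) (@lebesgue2_sigma_finite R).

Section TetrahedronIntegral.
Variable R : realType.
Local Notation mu := (@lebesgue_measure R).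
Local Notation T := (measurableTypeR R).
Local Notation mu3 := ((mu \x mu) \x mu)%E.
Local Notation R3 := (R * R * R)%type.
Implicit Types (A B C : {poly R}) (K : {poly {poly R}}) (p : R3).
Variables e1 e2 e3 : bool.

Lemma etaE p : eta p = p.1.1 / omega p.
Proof. by rewrite /eta /omega invf_div; ring. Qed.

Lemma chiE p : chi p = p.1.2 / omega_y p.
Proof. by rewrite /chi /omega_y invf_div; ring. Qed.

(* The flags tell which of the faces x = - omega, y = - omega_y and z = - 1 of
   the tetrahedron belong to the set. *)
Definition box p : bool :=
  [&& p.2 \in half e3 1, p.1.2 \in half e2 (omega_y p) & p.1.1 \in half e1 (omega p)].

Lemma half_norm e (c x : R) : x \in half e c -> `|x| <= c.
Proof. by rewrite ler_norml in_itv/=; case: e => /= /andP[h ->]; rewrite ?h ?ltW. Qed.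

Lemma half_div e (c x : R) : x \in half e c -> `|x / c| <= 1.
Proof.
move=> /half_norm xc; have [c0|c0] := ltP 0 c.
  by rewrite normrM normfV (gtr0_norm c0) ler_pdivrMr// mul1r.
have -> : c = 0 by apply/eqP; rewrite eq_le c0 (le_trans _ xc).
by rewrite invr0 mulr0 normr0.
Qed.

Lemma box_eta p : box p -> `|eta p| <= 1.
Proof. by rewrite etaE => /and3P[_ _ /half_div]. Qed.

Lemma box_chi p : box p -> `|chi p| <= 1.
Proof. by rewrite chiE => /and3P[_ /half_div]. Qed.

Lemma box_z p : box p -> `|p.2| <= 1.
Proof. by move=> /and3P[/half_norm]. Qed.

Lemma measurable_coord1 : measurable_fun setT (fun p : R3 => p.1.1).
Proof. exact: measurableT_comp measurable_fst measurable_fst. Qed.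

Lemma measurable_coord2 : measurable_fun setT (fun p : R3 => p.1.2).
Proof. exact: measurableT_comp measurable_snd measurable_fst. Qed.

Lemma measurable_coord3 : measurable_fun setT (fun p : R3 => p.2).
Proof. exact: measurable_snd. Qed.

Lemma measurable_omega : measurable_fun setT (@omega R).
Proof.
apply: measurable_funM => //; apply: measurable_funB; last exact: measurable_coord3.
apply: measurable_funB => //; apply: measurable_funM => //.
exact: measurable_coord2.
Qed.

Lemma measurable_omega_y : measurable_fun setT (@omega_y R).
Proof.
by apply: measurable_funM => //; apply: measurable_funB.
Qed.

Lemma measurable_quotient (f g : R3 -> R) : measurable_fun setT f ->
  measurable_fun setT g -> measurable_fun setT (fun p => f p / g p).
Proof.
move=> mf mg; apply: measurable_funM => //.
exact: measurableT_comp (@measurable_inv R) mg.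
Qed.

Lemma measurable_eta : measurable_fun setT (@eta R).
Proof.
rewrite (_ : @eta R = fun p => p.1.1 / omega p); last exact/funext/etaE.
exact: measurable_quotient measurable_coord1 measurable_omega.
Qed.

Lemma measurable_chi : measurable_fun setT (@chi R).
Proof.
rewrite (_ : @chi R = fun p => p.1.2 / omega_y p); last exact/funext/chiE.
exact: measurable_quotient measurable_coord2 measurable_omega_y.
Qed.

Lemma measurable_half e (f c : R3 -> R) : measurable_fun setT f ->
  measurable_fun setT c -> measurable_fun setT (fun p => f p \in half e (c p)).
Proof.
move=> mf mc; have mN : measurable_fun setT (fun p => - c p).
  exact: measurable_funN.
have -> : (fun p => f p \in half e (c p)) =
    (fun p => (if e then - c p <= f p else - c p < f p) && (f p <= c p)).
  by apply/funext => p; rewrite in_itv/=; case: e => /=.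
apply: measurable_and; last exact: measurable_fun_ler.
by case: e; [exact: measurable_fun_ler | exact: measurable_fun_ltr].
Qed.

Lemma measurable_box : measurable_fun setT box.
Proof.
apply: measurable_and; first exact: measurable_half measurable_coord3 _.
apply: measurable_and.
  exact: measurable_half measurable_coord2 measurable_omega_y.
exact: measurable_half measurable_coord1 measurable_omega.
Qed.

Definition tens A B C p : R := A.[eta p] * B.[chi p] * C.[p.2].

Definition btens A B C p : R := if box p then tens A B C p else 0.

Lemma measurable_tens A B C : measurable_fun setT (tens A B C).
Proof.
have mp (P : {poly R}) (f : R3 -> R) : measurable_fun setT f ->
    measurable_fun setT (fun p => P.[f p]).
  move=> mf; apply: (measurableT_comp (f := horner P)) => //.
  exact: measurable_poly.
apply: measurable_funM; last exact: mp measurable_coord3.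
apply: measurable_funM; first exact: mp measurable_eta.
exact: mp measurable_chi.
Qed.

Lemma measurable_btens A B C : measurable_fun setT (btens A B C).
Proof.
apply: measurable_fun_ifT => //; first exact: measurable_box.
exact: measurable_tens.
Qed.

Definition cube2 : set (R * R) := (`[(-1 : R), 1] `*` `[(-1 : R), 1])%classic.

Lemma box_cube p : box p -> (cube2 p.1 /\ p.2 \in `[(-1 : R), 1]).
Proof.
move=> bp; have := bp => /and3P[/half_norm z1 /half_norm y1 /half_norm x1].
move: z1 y1 x1; rewrite !ler_norml /omega /omega_y.
move=> /andP[z1 z2] /andP[y1 y2] /andP[x1 x2].
have in1 (x : R) : -1 <= x -> x <= 1 -> x \in `[(-1 : R), 1].
  by move=> h1 h2; rewrite in_itv/= h1.
by split; [split|]; apply: in1; lra.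
Qed.

Lemma mu_itv1 : mu `[(-1 : R), 1]%classic = 2%:E.
Proof. by rewrite lebesgue_measure_itv/= lte_fin ifT -?EFinB; [congr EFin; ring|lra]. Qed.

Lemma measurable_cube2 : measurable cube2.
Proof. exact: measurableX. Qed.

Lemma mu_cube2 : ((mu \x mu) cube2 < +oo)%E.
Proof. by rewrite product_measure1E// [X in (X * _)%E]mu_itv1 [X in (_ * X)%E]mu_itv1
  -EFinM ltry. Qed.

Lemma tens_bounded A B C : exists M, forall p, box p -> `|tens A B C p| <= M.
Proof.
have [MA hA] := poly_bounded A; have [MB hB] := poly_bounded B.
have [MC hC] := poly_bounded C; exists (MA * MB * MC) => p bp.
rewrite /tens !normrM; apply: ler_pM; rewrite ?mulr_ge0//.
  by apply: ler_pM; rewrite ?normr_ge0 ?hA ?hB ?box_eta ?box_chi.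
by rewrite hC ?box_z.
Qed.

Lemma btens_bounded A B C : exists M, forall p, `|btens A B C p| <= M.
Proof.
have [M hM] := tens_bounded A B C; exists `|M| => p; rewrite /btens.
by case: ifP => [/hM/le_trans->//|_]; rewrite ?normr0// ler_norm.
Qed.

Lemma integrable_btens A B C : mu3.-integrable setT (EFin \o btens A B C).
Proof.
pose D : set R3 := (cube2 `*` `[(-1 : R), 1])%classic.
have mD : measurable D by apply: measurableX => //; exact: measurable_cube2.
have [M hM] := btens_bounded A B C.
have : mu3.-integrable D (EFin \o btens A B C).
  apply: measurable_bounded_integrable => //.
  - rewrite [X in (X < _)%E](_ : _ = ((mu \x mu) cube2 * 2%:E)%E); last first.
      by rewrite -mu_itv1; apply: product_measure1E => //; exact: measurable_cube2.
    apply: lte_mul_pinfty; rewrite ?ltry//.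
    by rewrite ge0_fin_numE//; exact: mu_cube2.
  - apply: measurable_funTS; exact: measurable_btens.
  - exists M; split; first by rewrite num_real.
    by move=> r /ltW Mr p _; exact: le_trans (hM p) Mr.
move=> H; have [+ _] := @integrable_mkcond _ _ _ mu3 D (EFin \o btens A B C) mD.
move=> /(_ H); apply: eq_integrable => //.
move=> p _; rewrite patchE /=; case: ifPn => // /negP pD.
rewrite /btens; case: ifP => // /box_cube[h1 h2].
by exfalso; apply: pD; rewrite inE.
Qed.

Lemma integrable_btens_z A B C z :
  (mu \x mu)%E.-integrable setT (fun q => (btens A B C (q, z))%:E).
Proof.
have [M hM] := btens_bounded A B C.
have : (mu \x mu)%E.-integrable cube2 (EFin \o (fun q => btens A B C (q, z))).
  apply: measurable_bounded_integrable.
  - exact: measurable_cube2.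
  - exact: mu_cube2.
  - apply: measurable_funTS; apply: (measurableT_comp (measurable_btens A B C)).
    exact: measurable_fun_pair.
  - exists M; split; first by rewrite num_real.
    by move=> r /ltW Mr p _; exact: le_trans (hM _) Mr.
move=> H; have [+ _] := @integrable_mkcond _ _ _ (mu \x mu)%E cube2
  (EFin \o (fun q => btens A B C (q, z))) measurable_cube2.
move=> /(_ H); apply: eq_integrable => //.
move=> q _; rewrite patchE /=; case: ifPn => // /negP pD.
rewrite /btens; case: ifP => // /box_cube[h1 h2].
by exfalso; apply: pD; rewrite inE.
Qed.

(** If [omega_y p = 0], the interval forces y = 0 and both sides are 0, whatever value the quotient
    [chi p] takes. *)
Lemma omega_half e p : p.1.2 \in half e (omega_y p) ->
  omega p = omega_y p * (halfX R).[chi p].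
Proof.
move=> /half_norm; rewrite halfX.unlock chiE hornerZ hornerD hornerN hornerX hornerC.
have [v0|v0] := eqVneq (omega_y p) 0.
  rewrite v0 normr_le0 mul0r => /eqP y0.
  by move: v0; rewrite /omega /omega_y y0; lra.
move=> _; rewrite (_ : _ * (_ * _) = (omega_y p - p.1.2) / 2); last by field.
by rewrite /omega /omega_y; field.
Qed.

(** Fubini, x innermost and z outermost. Rescaling x yields the factor [omega], which is [omega_y]
    times [halfX] at chi, and rescaling y a second [omega_y]; these are the weights on the right. *)
Lemma integral_btens A B C : (\int[mu3]_p (btens A B C p)%:E =
  (integ A * (integ (halfX R * B) * integ (halfX R ^+ 2 * C)))%:E)%E.
Proof.
have H := @integral21_prod_meas1 _ _ (T * T)%type T R (@lebesgue2 R) mu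
  (fun p : T * T * T => (btens A B C p)%:E) (integrable_btens A B C).
transitivity (\int[mu]_z \int[mu \x mu]_q (btens A B C (q, z))%:E)%E.
  exact: esym H.
transitivity (\int[mu]_z (if z \in half e3 1 then
    ((integ A * integ (halfX R * B)) *: (halfX R ^+ 2 * C)).[z / 1] else 0)%:E)%E;
  last first.
  rewrite integral_if integral_half; last exact: ler01.
  by rewrite linearZ/= mul1r mulrA.
apply: eq_integral => z _.
have H' := @integral21_prod_meas1 _ _ T T R mu mu
  (fun q : T * T => (btens A B C (q, z))%:E) (integrable_btens_z A B C z).
transitivity (\int[mu]_y \int[mu]_x (btens A B C ((x, y), z))%:E)%E.
  exact: esym H'.
have [zI|zI] := boolP (z \in half e3 1); last first.
  apply: integral0_eq => y _; apply: integral0_eq => x _.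
  by rewrite /btens /box /= (negPf zI).
pose v := (1 - z) / 2.
have v0 : 0 <= v.
  by move: (half_norm zI); rewrite ler_norml /v; lra.
have vE : v = (halfX R).[z] by rewrite halfX.unlock !hornerE /v mulrC.
transitivity (\int[mu]_y (if y \in half e2 v then
    ((integ A * v * C.[z]) *: (halfX R * B)).[y / v] else 0)%:E)%E; last first.
  rewrite integral_if integral_half; last exact: v0.
  apply: (congr1 (@EFin R)).
  by rewrite divr1 hornerZ hornerM horner_exp -vE linearZ/=; ring.
apply: eq_integral => y _.
have [yI|yI] := boolP (y \in half e2 v); last first.
  apply: integral0_eq => x _.
  by rewrite /btens /box /= (negPf yI) andbF.
pose w := (1 - 2 * y - z) / 4.
have w0 : 0 <= w.
  by move: (half_norm yI); rewrite ler_norml /v /w; lra.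
have wE : w = v * (halfX R).[y / v].
  by have := @omega_half e2 (0, y, z) yI; rewrite chiE.
transitivity (\int[mu]_x (if x \in half e1 w then
    ((B.[y / v] * C.[z]) *: A).[x / w] else 0)%:E)%E; last first.
  rewrite integral_if integral_half; last exact: w0.
  apply: (congr1 (@EFin R)).
  by rewrite linearZ/= hornerZ hornerM wE; ring.
apply: eq_integral => x _.
rewrite /btens /box /= zI yI /=; congr EFin.
by case: ifP => // _; rewrite /tens etaE chiE/= hornerZ; ring.
Qed.

End TetrahedronIntegral.

Section Evaluation.
Variable R : realType.
Implicit Types (B C : {poly R}) (K : {poly {poly R}}) (x y : R).

Definition ev x y K : R := (K.[x%:P]).[y].

Lemma evD x y K K' : ev x y (K + K') = ev x y K + ev x y K'.
Proof. by rewrite /ev !hornerD. Qed.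

Lemma evN x y K : ev x y (- K) = - ev x y K.
Proof. by rewrite /ev !hornerN. Qed.

Lemma evM x y K K' : ev x y (K * K') = ev x y K * ev x y K'.
Proof. by rewrite /ev !hornerM. Qed.

Lemma evX x y K n : ev x y (K ^+ n) = ev x y K ^+ n.
Proof. by rewrite /ev !horner_exp. Qed.

Lemma ev0 x y : ev x y 0 = 0.
Proof. by rewrite /ev !horner0. Qed.

Lemma ev_map x y B : ev x y B^:P = B.[x].
Proof. by rewrite /ev horner_map hornerC. Qed.

Lemma ev_polyC x y C : ev x y C%:P = C.[y].
Proof. by rewrite /ev hornerC. Qed.

Lemma ev_var x y : ev x y 'X = x.
Proof. by rewrite /ev hornerX hornerC. Qed.

Definition evE := (evD, evN, evM, evX, ev0, ev_map, ev_polyC, ev_var).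

End Evaluation.

(** * Pairings as integrals over the box in eta, chi, z *)

Section TetrahedronPairing.
Variable R : realType.
Local Notation mu := (@lebesgue_measure R).
Local Notation mu3 := ((mu \x mu) \x mu)%E.
Local Notation T := (measurableTypeR R).
Local Notation R3 := (R * R * R)%type.
Implicit Types (A B C : {poly R}) (K : {poly {poly R}}) (p : R3).

Lemma tetP p : tet p <-> box true true true p.
Proof.
split.
  case=> t [t0 t1 ->].
  have h0 := t0 ord0; have h1 := t0 (lift ord0 ord0).
  have h2 := t0 (lift ord0 (lift ord0 ord0)).
  have h3 := t0 (lift ord0 (lift ord0 (lift ord0 ord0))).
  move: t1; rewrite !big_ord_recl !big_ord0 /= => t1.
  move: h0 h1 h2 h3 t1; set a := t _; set b := t _; set c := t _; set d := t _.
  move=> h0 h1 h2 h3 t1.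
  rewrite /box /omega /omega_y !in_itv /= /GRing.scale /=.
  by apply/and3P; split; apply/andP; split; lra.
case: p => -[x y] z; rewrite /box !in_itv/= /omega /omega_y/=.
move=> /and3P[/andP[z1 z2] /andP[y1 y2] /andP[x1 x2]].
pose w := (1 - 2 * y - z) / 4.
(* The barycentric coordinates of the point, each half the slack in an inequality defining [box]. *)
exists (fun i : 'I_4 => nth 0 [:: (w - x) / 2; (w + x) / 2;
  ((1 - z) / 2 + y) / 2; (1 + z) / 2] i).
rewrite !big_ord_recl !big_ord0 /=; split.
- by move=> [[|[|[|[|//]]]] ?] /=; rewrite /w; lra.
- by rewrite /w; field.
- by congr (_, _, _); rewrite /w /=; rewrite /GRing.scale/=; field.
Qed.

Lemma measurable_tet : measurable (@tet R).
Proof.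
rewrite (_ : @tet R = (box true true true @^-1` [set true])%classic).
  by rewrite -[X in measurable X]setTI; exact: measurable_box.
by apply/seteqP; split => p /tetP.
Qed.

Lemma box_tet e1 e2 e3 p : box e1 e2 e3 p -> tet p.
Proof.
move=> bp; apply/tetP; move: bp; rewrite /box !in_itv/=.
by case: e1; case: e2; case: e3 => /= /and3P[/andP[z1 ->] /andP[y1 ->] /andP[x1 ->]];
  rewrite ?(ltW z1) ?(ltW y1) ?(ltW x1) ?z1 ?y1 ?x1.
Qed.

(* lebesgue3.-integrable elaborates to the product of the Borel structure of R,
   whereas lebesgue3 lives on the structure generated by intervals: the two have
   the same measurable sets but different displays, and the pushforward by the
   identity goes from one to the other. *)
Lemma lebesgue3_integrable (f : R3 -> \bar R) :
  mu3.-integrable (@tet R) f -> (@lebesgue3 R).-integrable (@tet R) f.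
Proof.
move=> intf.
have mid : measurable_fun (setT : set (T * T * T)) (id : T * T * T -> R3).
  move=> _ A mA; rewrite setTI; exact: mA.
have [mf foo] := integrableP _ _ _ intf.
rewrite unlock; apply/asboolP; split; first exact: mf.
apply: le_lt_trans foo.
have := @ge0_integral_pushforward _ _ (T * T * T)%type R3 R id mid mu3 (@tet R)
  (fun p => `|f p|%E) measurable_tet.
move=> -> //; apply: measurableT_comp => //; exact: mf.
Qed.

Section Flags.
Variables e1 e2 e3 : bool.
Local Notation box := (box e1 e2 e3).

Definition bev A K p : R := if box p then A.[eta p] * ev (chi p) p.2 K else 0.

Lemma integral_bev A K : mu3.-integrable setT (EFin \o bev A K) /\
  (\int[mu3]_p (bev A K p)%:E = (integ A * int2 K)%:E)%E.
Proof.
(* Induction on [K] in [B^:P * K] with [B] arbitrary: in a Horner step [K * 'X + c%:P] the variable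
   is absorbed into [B], and [c] leaves a product of one polynomial per variable. *)
rewrite -[K]mul1r -[1](map_polyC polyC 1).
elim/poly_ind: K (1%:P) => [|K c IH] B.
  rewrite mulr0 (_ : bev A 0 = fun=> 0); last first.
    by apply/funext => p; rewrite /bev evE mulr0 if_same.
  by split; [exact: integrable0 | rewrite integral0 raddf0 mulr0].
have [iK eK] := IH (B * 'X).
have iB := integrable_btens e1 e2 e3 A B c.
have E p : bev A (B^:P * (K * 'X + c%:P)) p =
    bev A ((B * 'X)^:P * K) p + btens e1 e2 e3 A B c p.
  rewrite /bev /btens; case: ifP; rewrite ?addr0// => _.
  by rewrite /tens !rmorphM/= map_polyX !evE; ring.
split.
  have := integrableD measurableT iK iB.
  by apply: eq_integrable => // p _; rewrite /= E.
under eq_integral => p _ do rewrite E EFinD.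
rewrite integralD//= eK integral_btens -EFinD; congr EFin.
rewrite -mulrDr -int2_tensor -raddfD; congr (_ * int2 _).
by rewrite rmorphM/= map_polyX; ring.
Qed.

(** Two terms, because the eta component of the pairing carries a different polynomial in eta from
    the other two. *)
Lemma pairing_box (w b : R3 -> R3) A1 K1 A2 K2 :
  (forall p, tet p -> dot (w p) (b p) = bev A1 K1 p + bev A2 K2 p) ->
  pairing_integrable w b /\
  pairing w b = integ A1 * int2 K1 + integ A2 * int2 K2.
Proof.
move=> E; have [i1 I1] := integral_bev A1 K1; have [i2 I2] := integral_bev A2 K2.
have iS := integrableD measurableT i1 i2.
have tetE p : ((fun p => (dot (w p) (b p))%:E) \_ (@tet R) p =
    (bev A1 K1 p)%:E + (bev A2 K2 p)%:E)%E.
  rewrite patchE; case: ifPn => [|/negP tp]; first by rewrite inE => /E ->.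
  have nb : box p = false.
    by apply/negP => /box_tet h; apply: tp; rewrite inE.
  by rewrite /bev nb adde0.
have iT : mu3.-integrable (@tet R) (fun p => (dot (w p) (b p))%:E).
  have [_ +] := @integrable_mkcond _ _ _ mu3 (@tet R)
    (fun p => (dot (w p) (b p))%:E) measurable_tet.
  move=> H; apply: H; move: iS; apply: eq_integrable => //.
split; first exact: lebesgue3_integrable.
rewrite /pairing /Rintegral integral_mkcond.
under eq_integral => p _ do rewrite tetE.
by rewrite [X in fine X](integralD measurableT i1 i2) I1 I2.
Qed.

End Flags.

End TetrahedronPairing.

(** * Directional derivatives *)

Section LineDerivatives.
Local Open Scope classical_set_scope.
Local Open Scope ring_scope.
Variable R : realType.
Local Notation R3 := (R * R * R)%type.
Implicit Types (f : R3 -> R) (p v : R3) (phi psi : R -> R).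

Lemma derive_line f p v d :
  is_derive (0 : R) 1 (fun t => f (t *: v + p)) d -> 'D_v f p = d.
Proof.
move=> [_ <-]; rewrite /derive.
set g := (X in lim (X @ _)%classic); set g' := (X in _ = lim (X @ _)%classic).
suff -> : g = g' by [].
apply/funext => h; rewrite /g /g' /=.
by rewrite addr0 [h *: 1]mulr1 scale0r add0r.
Qed.

(** A line through a point of a face lies, on at least one side of that point, in the closed
    half-space beyond the face, where [jacobi_hat] is 0. *)
Definition vanishes_on_side phi : Prop := phi 0 = 0 /\
  ((\forall t \near 0^'+, phi t = 0) \/ (\forall t \near 0^'-, phi t = 0)).

Lemma vanishes_on_sideM phi psi :
  vanishes_on_side phi -> vanishes_on_side (fun t => phi t * psi t).
Proof.
move=> [p0 H]; split; first by rewrite p0 mul0r.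
case: H => H; [left|right]; move: H; apply: filterS => t ->; by rewrite mul0r.
Qed.

(* The derivative is 0 if it exists; if not, it takes the default value 0. *)
Lemma derive_vanishing f p v :
  vanishes_on_side (fun t => f (t *: v + p)) -> 'D_v f p = 0.
Proof.
move=> [f0 H]; rewrite /derive; set g := (X in (X @ _)%classic).
have gE t : f (t *: v + p) = 0 -> g t = 0.
  by rewrite /g /= => ->; rewrite -[p]add0r -(scale0r v) f0 subrr scaler0.
have [cg|/dvgP ->//] := pselect (cvg (g @ (0 : R)^')%classic).
by case: H => H; [rewrite cvg_at_rightE//|rewrite cvg_at_leftE//];
  apply: lim_near_cst => //; apply: filterS H => t; exact: gE.
Qed.

Lemma near_affine_gt0 (c d : R) : 0 < c -> \forall t \near (0 : R), 0 < c + t * d.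
Proof.
move=> c0; have : ((c + t * d) @[t --> (0 : R)] --> c)%classic.
  rewrite -[X in (_ --> X)%classic]addr0 -[X in _ + X](mul0r d).
  apply: cvgD; first exact: cvg_cst.
  by apply: cvgM; [exact: cvg_id | exact: cvg_cst].
by move=> /cvgr_gt/(_ _ c0).
Qed.

Lemma near_affine_le0 (d : R) :
  (\forall t \near (0 : R)^'+, t * d <= 0) \/ (\forall t \near (0 : R)^'-, t * d <= 0).
Proof.
have [d0|d0] := leP d 0; [left|right]; near=> t.
  by rewrite mulr_ge0_le0// ltW//; near: t; exact: nbhs_right_gt.
by rewrite mulr_le0_ge0 ?(ltW d0).
Unshelve. all: by end_near. Qed.

Lemma jacobi_hatE n k (x : R) : -1 <= x -> jacobi_hat n k x = (hat R n k).[x].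
Proof.
move=> x1; rewrite /jacobi_hat /Rintegral -(deriv_hat R n k).
by rewrite integral_deriv_poly// hat_hornerN1 subr0.
Qed.

Lemma jacobi_hat_le n k (x : R) : x <= -1 -> jacobi_hat n k x = 0.
Proof.
rewrite le_eqVlt => /predU1P[->|x1]; first by rewrite jacobi_hatE// hat_hornerN1.
by rewrite /jacobi_hat set_itv_ge ?Rintegral_set0//= bnd_simp -ltNge.
Qed.

(** On a line all factors f, g, h take this form with [a] and [b] affine in the parameter; those in
    z have m = 0 and b = 1. The face is a + b = 0. *)
Definition hom n k m (a b : R) : R := jacobi_hat n k (a / b) * b ^+ m.

Lemma hom_eq0 n k m a b : 0 < b -> a + b <= 0 -> hom n k m a b = 0.
Proof.
move=> b0 ab; rewrite /hom jacobi_hat_le ?mul0r// ler_pdivrMr//; lra.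
Qed.

Lemma is_derive_affine (c d : R) : is_derive (0 : R) 1 (fun t : R => c + t * d) d.
Proof.
have := @is_deriveD _ _ _ (cst c) (fun t : R => t * d) 0 1 0 d.
rewrite add0r; apply.
have := @is_deriveM _ _ id (cst d) (0 : R) 1 1 0.
by rewrite scale0r add0r [cst d 0 *: 1]mulr1; apply.
Qed.

Lemma is_derive_hom n k m (a b da db : R) : 0 < b -> 0 < a + b ->
  is_derive (0 : R) 1 (fun t => hom n k m (a + t * da) (b + t * db))
   (b ^+ m / b * ((da - a / b * db) * (jacobi R n.-1 k 0).[a / b]
                  + m%:R * (hat R n k).[a / b] * db)).
Proof.
move=> b0 ab0.
pose A := fun t : R => a + t * da; pose B := fun t : R => b + t * db.
have dA : is_derive (0 : R) 1 A da := is_derive_affine a da.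
have dB : is_derive (0 : R) 1 B db := is_derive_affine b db.
have A0 : A 0 = a by rewrite /A mul0r addr0.
have B0 : B 0 = b by rewrite /B mul0r addr0.
have bn0 : b != 0 by rewrite gt_eqF.
have dV : is_derive (0 : R) 1 (fun t => (B t)^-1) (- b ^- 2 * db).
  by have := @is_deriveV _ B 0 db 1; rewrite B0; apply.
have dQ : is_derive (0 : R) 1 (A * (fun t => (B t)^-1)) ((da - a / b * db) / b).
  have := is_deriveM dA dV; rewrite A0 B0.
  by rewrite (_ : _ + _ = (da - a / b * db) / b)//= /GRing.scale/=; field.
have dP : is_derive (0 : R) 1 (horner (hat R n k) \o (A * (fun t => (B t)^-1)))
    ((jacobi R n.-1 k 0).[a / b] * ((da - a / b * db) / b)).
  apply: is_derive1_comp => //.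
  rewrite (_ : (A * (fun t => (B t)^-1)) 0 = a / b).
    by rewrite -(deriv_hat R n k); exact: is_derive_poly.
  by rewrite -A0 -B0.
have dX : is_derive (0 : R) 1 (B ^+ m) (m%:R * b ^+ m.-1 * db).
  by have := is_deriveX m dB; rewrite B0.
have dT := is_deriveM dP dX.
apply: (near_eq_is_derive (f := (horner (hat R n k) \o (A * (fun t => (B t)^-1)))
   * B ^+ m)); last first.
  apply: DeriveDef; first exact: (@ex_derive _ _ _ _ _ _ _ dT).
  rewrite (@derive_val _ _ _ _ _ _ _ dT) /= -[(A * _) 0]/(A 0 / B 0).
  rewrite -[(B ^+ m) 0]/(_) A0 /GRing.scale/=.
  have -> : (B ^+ m) 0 = b ^+ m by rewrite -B0; elim: m {dX dT} => // m IH; rewrite !exprS -IH.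
  rewrite B0; case: m {dX dT} => [|m]; first by rewrite !expr0 /=; field.
  by rewrite /= exprS; field.
near=> t.
have Bt : 0 < B t by near: t; exact: near_affine_gt0.
have ABt : 0 < A t + B t.
  have -> : A t + B t = (a + b) + t * (da + db) by rewrite /A /B; ring.
  by near: t; exact: near_affine_gt0.
rewrite /hom -/(A t) -/(B t) jacobi_hatE; last first.
  by rewrite ler_pdivlMr//; lra.
congr (_ * _); elim: m {dX dT} => // m IH; by rewrite !exprS -IH.
Unshelve. all: by end_near. Qed.

Lemma vanishes_on_side_hom n k m (a b da db : R) : 0 < b -> a + b = 0 ->
  vanishes_on_side (fun t => hom n k m (a + t * da) (b + t * db)).
Proof.
move=> b0 ab0; split; first by rewrite !mul0r !addr0 hom_eq0// ab0.
have H t : 0 < b + t * db -> t * (da + db) <= 0 ->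
    hom n k m (a + t * da) (b + t * db) = 0.
  by move=> b1 t1; apply: hom_eq0 => //; lra.
case: (near_affine_le0 (da + db)) => H1; [left|right]; near=> t; apply: H.
- by near: t; apply: cvg_within; exact: near_affine_gt0.
- by near: t.
- by near: t; apply: cvg_within; exact: near_affine_gt0.
- by near: t.
Unshelve. all: by end_near. Qed.

End LineDerivatives.

(** * Values and gradients of f, g, h inside the tetrahedron and on its faces *)

Section Gradients.
Variable R : realType.
Local Notation R3 := (R * R * R)%type.
Implicit Types (p v : R3) (i j k n m l : nat).

Lemma omega_line p v t : omega (t *: v + p) =
  omega p + t * (- (v.1.2 / 2 + v.2 / 4)).
Proof. by rewrite /omega /= /GRing.scale/=; field. Qed.

Lemma omega_y_line p v t : omega_y (t *: v + p) = omega_y p + t * (- (v.2 / 2)).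
Proof. by rewrite /omega_y /= /GRing.scale/=; field. Qed.

Lemma coord1_line p v t : p.1.1 + t * v.1.1 = (t *: v + p).1.1.
Proof. by rewrite addrC. Qed.

Lemma coord2_line p v t : p.1.2 + t * v.1.2 = (t *: v + p).1.2.
Proof. by rewrite addrC. Qed.

Lemma coord3_line p v t : p.2 + t * v.2 = (t *: v + p).2.
Proof. by rewrite addrC. Qed.

Lemma f_line i p v t : f_ i (t *: v + p) =
  hom i 0 i (p.1.1 + t * v.1.1) (omega p + t * (- (v.1.2 / 2 + v.2 / 4))).
Proof. by rewrite coord1_line -omega_line /hom -etaE. Qed.

Lemma jhat_y_line j c p v t : jacobi_hat j c (chi (t *: v + p)) *
    omega_y (t *: v + p) ^+ j =
  hom j c j (p.1.2 + t * v.1.2) (omega_y p + t * (- (v.2 / 2))).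
Proof. by rewrite coord2_line -omega_y_line /hom -chiE. Qed.

Lemma jhat_z_line k c p v t : jacobi_hat k c (t *: v + p).2 =
  hom k c 0 (p.2 + t * v.2) (1 + t * 0).
Proof. by rewrite coord3_line /hom expr0 mulr1 mulr0 addr0 divr1. Qed.

Lemma tet_bounds p : tet p -> [/\ -1 <= p.2, p.2 <= 1, - omega_y p <= p.1.2,
  p.1.2 <= omega_y p & - omega p <= p.1.1 <= omega p].
Proof.
by move=> /tetP; rewrite /box !in_itv/= => /and3P[/andP[-> ->] /andP[-> ->] ->].
Qed.

Lemma boxE e1 e2 e3 p : tet p -> box e1 e2 e3 p =
  [&& e3 || (-1 < p.2), e2 || (- omega_y p < p.1.2) & e1 || (- omega p < p.1.1)].
Proof.
move=> /tet_bounds[z1 z2 y1 y2 /andP[x1 x2]].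
by rewrite /box !in_itv/= z2 y2 x2 !andbT; case: e1; case: e2; case: e3;
  rewrite /= ?z1 ?y1 ?x1.
Qed.

Lemma omegaE p : omega p = (omega_y p - p.1.2) / 2.
Proof. by rewrite /omega /omega_y; field. Qed.

Section Interior.
Variable p : R3.
Hypothesis tp : tet p.

Lemma tet_omega_gt0 : - omega p < p.1.1 -> 0 < omega p.
Proof. by have [_ _ _ _ /andP[_ x2]] := tet_bounds tp; lra. Qed.

Lemma tet_omega_y_gt0 : - omega_y p < p.1.2 -> 0 < omega_y p.
Proof. by have [_ _ _ y2 _] := tet_bounds tp; lra. Qed.

Lemma omega_gt0_y : 0 < omega p -> 0 < omega_y p.
Proof. by have [_ _ y1 _ _] := tet_bounds tp; rewrite omegaE; lra. Qed.

Lemma eta_omega : p.1.1 = eta p * omega p.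
Proof.
rewrite etaE; have [w0|w0] := eqVneq (omega p) 0; last by rewrite divfK.
by have [_ _ _ _] := tet_bounds tp; rewrite w0 mulr0; lra.
Qed.

Lemma chi_omega_y : p.1.2 = chi p * omega_y p.
Proof.
rewrite chiE; have [v0|v0] := eqVneq (omega_y p) 0; last by rewrite divfK.
by have [_ _ + + _] := tet_bounds tp; rewrite v0 mulr0; lra.
Qed.

Lemma f_in n : - omega p < p.1.1 ->
  f_ n.+2 p = (hat R n.+2 0).[eta p] * omega p ^+ n.+2 /\
  grad (f_ n.+2) p = omega p ^+ n.+1 *:
    ((legendre R n.+1).[eta p],
     eta p / 2 * (legendre R n.+1).[eta p] - n.+2%:R / 2 * (hat R n.+2 0).[eta p],
     eta p / 4 * (legendre R n.+1).[eta p] - n.+2%:R / 4 * (hat R n.+2 0).[eta p]).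
Proof.
move=> x1; have w0 := tet_omega_gt0 x1; have wn0 : omega p != 0 by rewrite gt_eqF.
have s0 : 0 < p.1.1 + omega p by lra.
split.
  rewrite /f_ /legendre_hat jacobi_hatE// etaE ler_pdivlMr//; lra.
have D v : 'D_v (f_ n.+2) p = omega p ^+ n.+1 *
    ((v.1.1 + eta p * (v.1.2 / 2 + v.2 / 4)) * (legendre R n.+1).[eta p]
     - n.+2%:R * (hat R n.+2 0).[eta p] * (v.1.2 / 2 + v.2 / 4)).
  apply: derive_line.
  rewrite (_ : (fun t => _) = fun t => hom n.+2 0 n.+2 (p.1.1 + t * v.1.1)
     (omega p + t * (- (v.1.2 / 2 + v.2 / 4)))); last first.
    by apply/funext => t; rewrite f_line.
  have := is_derive_hom n.+2 0 n.+2 v.1.1 (- (v.1.2 / 2 + v.2 / 4)) w0 s0.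
  have e : omega p ^+ n.+2 / omega p = omega p ^+ n.+1.
    by rewrite exprS mulrAC divff// mul1r.
  rewrite -etaE /legendre e /=.
  by rewrite (_ : _ * (_ + _) = omega p ^+ n.+1 *
    ((v.1.1 + eta p * (v.1.2 / 2 + v.2 / 4)) * (jacobi R n.+1 0 0).[eta p]
     - n.+2%:R * (hat R n.+2 0).[eta p] * (v.1.2 / 2 + v.2 / 4))) //; ring.
rewrite /grad !D /ex /ey /ez /=.
by congr (_, _, _); rewrite /GRing.scale/=; field.
Qed.

Lemma vanishing_grad (f : R3 -> R) :
  (forall v, vanishes_on_side (fun t => f (t *: v + p))) -> f p = 0 /\ grad f p = 0.
Proof.
move=> H; split; last by rewrite /grad !derive_vanishing.
by have [] := H 0; rewrite scaler0 add0r.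
Qed.

Lemma f_out n : p.1.1 <= - omega p -> f_ n.+2 p = 0 /\ grad (f_ n.+2) p = 0.
Proof.
move=> x1; have [_ _ y1 y2 /andP[x2 x3]] := tet_bounds tp.
have s0 : p.1.1 + omega p = 0 by apply/eqP; rewrite eq_le; apply/andP; split; lra.
have [w0|w0] := ltP 0 (omega p).
  apply: vanishing_grad => v.
  rewrite (_ : (fun t => _) = fun t => hom n.+2 0 n.+2 (p.1.1 + t * v.1.1)
     (omega p + t * (- (v.1.2 / 2 + v.2 / 4)))).
    exact: vanishes_on_side_hom.
  by apply/funext => t; rewrite f_line.
(* On the edge [omega p = 0] there is no face argument. Without an x component in the direction, eta
   stays 0 and f is a constant times a power at least 2 of the parameter; along x, [omega] and hence
   f stay 0. *)
have w00 : omega p = 0 by lra.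
have x0 : p.1.1 = 0 by lra.
have h0 n' t : hom n.+2 0 n.+2 t 0 = 0 :> R by rewrite /hom expr0n mulr0.
split; first by rewrite /f_ w00 expr0n mulr0.
have D v : v.1.1 = 0 -> 'D_v (f_ n.+2) p = 0.
  move=> v0; apply: derive_line.
  set d := - (v.1.2 / 2 + v.2 / 4).
  rewrite (_ : (fun t => _) = cst (jacobi_hat n.+2 0 0) * (fun t => 0 + t * d) ^+ n.+2);
    last first.
    apply/funext => t; rewrite f_line v0 x0 w00 mulr0 addr0 /hom mul0r.
    by rewrite !fctE.
  have := is_deriveM (is_derive_cst (jacobi_hat n.+2 0 (0 : R)) (0 : R) 1)
    (is_deriveX n.+2 (is_derive_affine 0 d)).
  rewrite /= mul0r addr0 expr0n/= mulr0 scale0r scaler0 scaler0 addr0.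
  exact.
have Dx : 'D_(ex R) (f_ n.+2) p = 0.
  apply: derive_vanishing.
  have E t : f_ n.+2 (t *: ex R + p) = 0.
    by rewrite f_line /= mul0r mul0r addr0 oppr0 mulr0 addr0 w00 h0.
  by split; [exact: E | left; apply: nearW].
by rewrite /grad Dx !D.
Qed.

Section Jhat.
Variables (m c : nat).
Local Notation g := (fun q : R3 => jacobi_hat m.+1 c (chi q) * omega_y q ^+ m.+1).

Lemma is_derive_g v : - omega_y p < p.1.2 ->
  is_derive (0 : R) 1 (fun t => g (t *: v + p)) (omega_y p ^+ m *
    ((v.1.2 + chi p * (v.2 / 2)) * (jacobi R m c 0).[chi p]
     - m.+1%:R * (hat R m.+1 c).[chi p] * (v.2 / 2))).
Proof.
move=> y1; have w0 := tet_omega_y_gt0 y1.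
have wn0 : omega_y p != 0 by rewrite gt_eqF.
have s0 : 0 < p.1.2 + omega_y p by lra.
rewrite (_ : (fun t => _) = fun t => hom m.+1 c m.+1 (p.1.2 + t * v.1.2)
   (omega_y p + t * (- (v.2 / 2)))); last first.
  by apply/funext => t; rewrite jhat_y_line.
have := is_derive_hom m.+1 c m.+1 v.1.2 (- (v.2 / 2)) w0 s0.
have e : omega_y p ^+ m.+1 / omega_y p = omega_y p ^+ m.
  by rewrite exprS mulrAC divff// mul1r.
rewrite -chiE e /=.
by rewrite (_ : _ * (_ + _) = omega_y p ^+ m *
  ((v.1.2 + chi p * (v.2 / 2)) * (jacobi R m c 0).[chi p]
   - m.+1%:R * (hat R m.+1 c).[chi p] * (v.2 / 2))) //; ring.
Qed.

Lemma g_in : - omega_y p < p.1.2 ->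
  g p = (hat R m.+1 c).[chi p] * omega_y p ^+ m.+1 /\
  grad g p = omega_y p ^+ m *:
    (0, (jacobi R m c 0).[chi p],
     chi p / 2 * (jacobi R m c 0).[chi p] - m.+1%:R / 2 * (hat R m.+1 c).[chi p]).
Proof.
move=> y1; split.
  have w0 := tet_omega_y_gt0 y1.
  rewrite jacobi_hatE// chiE ler_pdivlMr//; lra.
rewrite /grad !(derive_line (is_derive_g _ y1)) /ex /ey /ez /=.
by congr (_, _, _); rewrite /GRing.scale/=; field.
Qed.

Lemma vanishes_g v : p.1.2 <= - omega_y p -> 0 < omega_y p ->
  vanishes_on_side (fun t => g (t *: v + p)).
Proof.
move=> y1 w0; have [_ _ y2 _ _] := tet_bounds tp.
rewrite (_ : (fun t => _) = fun t => hom m.+1 c m.+1 (p.1.2 + t * v.1.2)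
   (omega_y p + t * (- (v.2 / 2)))); last first.
  by apply/funext => t; rewrite jhat_y_line.
apply: vanishes_on_side_hom => //; lra.
Qed.

Lemma g_out : p.1.2 <= - omega_y p -> 0 < omega_y p -> g p = 0 /\ grad g p = 0.
Proof. by move=> y1 w0; apply: vanishing_grad => v; exact: vanishes_g. Qed.

End Jhat.

Section JhatZ.
Variables (l c : nat).
Local Notation h := (fun q : R3 => jacobi_hat l.+1 c q.2).

Lemma is_derive_h v : -1 < p.2 ->
  is_derive (0 : R) 1 (fun t => h (t *: v + p)) (v.2 * (jacobi R l c 0).[p.2]).
Proof.
move=> z1; have s0 : 0 < p.2 + 1 by lra.
rewrite (_ : (fun t => _) = fun t => hom l.+1 c 0 (p.2 + t * v.2) (1 + t * 0));
  last by apply/funext => t; rewrite jhat_z_line.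
have := is_derive_hom l.+1 c 0 v.2 0 (@ltr01 R) s0.
by rewrite expr0 divr1 mul1r mulr0 subr0 mulr0 addr0 divr1.
Qed.

Lemma h_in : -1 < p.2 -> h p = (hat R l.+1 c).[p.2] /\
  grad h p = (0, 0, (jacobi R l c 0).[p.2]).
Proof.
move=> z1; split; first by rewrite jacobi_hatE// ltW.
rewrite /grad !(derive_line (is_derive_h _ z1)) /ex /ey /ez /=.
by rewrite !mul0r mul1r.
Qed.

Lemma vanishes_h v : p.2 <= -1 -> vanishes_on_side (fun t => h (t *: v + p)).
Proof.
move=> z1; have [z2 _ _ _ _] := tet_bounds tp.
rewrite (_ : (fun t => _) = fun t => hom l.+1 c 0 (p.2 + t * v.2) (1 + t * 0));
  last by apply/funext => t; rewrite jhat_z_line.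
apply: vanishes_on_side_hom => //; lra.
Qed.

Lemma h_out : p.2 <= -1 -> h p = 0 /\ grad h p = 0.
Proof. by move=> z1; apply: vanishing_grad => v; exact: vanishes_h. Qed.

End JhatZ.

End Interior.

End Gradients.

(** * Components of the primal functions *)

Section PrimalExpansion.
Variable R : realType.
Local Notation R3 := (R * R * R)%type.
Local Notation Q := {poly {poly R}}.
Implicit Types (p : R3) (n m l : nat) (E : Q * Q * Q).

(* F a1 (X x Z) + L a2 (Z x E) + L a3 (E x X), where E, X, Z are omega omega_y
   times the gradients of eta, chi, z and a1, a2, a3 the values of the components
   of the coefficient triple. *)
Definition piola (F L : {poly R}) E p : R3 :=
  let a := F.[eta p] * ev (chi p) p.2 E.1.1 in
  let b := L.[eta p] * ev (chi p) p.2 E.1.2 in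
  let c := L.[eta p] * ev (chi p) p.2 E.2 in
  (omega p * a - eta p / 2 * omega_y p * b - eta p * (1 - chi p) / 4 * c,
   omega_y p * b - chi p / 2 * c, c).

Lemma omega_chi p : tet p -> omega p = omega_y p * (halfX R).[chi p].
Proof.
move=> tp; apply: (@omega_half R true p); have [_ _ y1 y2 _] := tet_bounds tp.
by rewrite in_itv/= y1.
Qed.

Lemma chi_halfX (c : R) : c = 1 - 2 * (halfX R).[c].
Proof. by rewrite halfX.unlock hornerZ hornerD hornerN hornerX hornerC; field. Qed.

Lemma halfX_z p : (halfX R).[p.2] = omega_y p.
Proof. by rewrite halfX.unlock hornerZ hornerD hornerN hornerX hornerC /omega_y; field. Qed.

Lemma cross0v (u : R3) : cross 0 u = 0.
Proof. by rewrite /cross /= !mul0r subrr. Qed.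

Lemma crossv0 (u : R3) : cross u 0 = 0.
Proof. by rewrite /cross /= !mulr0 subrr. Qed.

Definition tri (a b c : R) (f g h : R3 -> R) p : R3 :=
  (a * f p) *: cross (grad g p) (grad h p)
  + (b * g p) *: cross (grad h p) (grad f p)
  + (c * h p) *: cross (grad f p) (grad g p).

Lemma triE n m l (a b c : R) p : tet p ->
  tri a b c (f_ n.+2) (g_ n.+2 m.+1) (h_ n.+2 m.+1 l.+1) p =
  if box false false false p then
    piola (hat R n.+2 0) (legendre R n.+1)
      (sc a (prA R n m l) + sc b (prB R n m l) + sc c (prC R n m l)) p
  else 0.
Proof.
move=> tp; rewrite boxE//=.
(* The face x = - omega comes first because it contains the edge [omega p = 0] and the apex: off it
   [omega] and [omega_y] are positive. *)
have [x1|x1] := ltP (- omega p) p.1.1; last first.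
  have [f0 df0] := f_out tp n x1; rewrite !andbF /tri f0 df0.
  by rewrite mulr0 scale0r crossv0 cross0v !scaler0 !addr0.
have w0 := tet_omega_gt0 tp x1; have v0 := omega_gt0_y tp w0.
have [y1|y1] := ltP (- omega_y p) p.1.2; last first.
  have [g0 dg0] : g_ n.+2 m.+1 p = 0 /\ grad (g_ n.+2 m.+1) p = 0.
    exact: g_out.
  rewrite andbF /tri g0 dg0.
  by rewrite mulr0 scale0r crossv0 cross0v !scaler0 !addr0.
have [z1|z1] := ltP (-1) p.2; last first.
  have [h0 dh0] : h_ n.+2 m.+1 l.+1 p = 0 /\ grad (h_ n.+2 m.+1 l.+1) p = 0.
    exact: h_out.
  rewrite /tri h0 dh0.
  by rewrite mulr0 scale0r crossv0 cross0v !scaler0 !addr0.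
have [fE dfE] := f_in tp n x1.
have [gE dgE] : g_ n.+2 m.+1 p = _ /\ grad (g_ n.+2 m.+1) p = _ :=
  g_in tp m (2 * n.+2) y1.
have [hE dhE] : h_ n.+2 m.+1 l.+1 p = _ /\ grad (h_ n.+2 m.+1 l.+1) p = _ :=
  h_in l (2 * n.+2 + 2 * m.+1) z1.
rewrite /tri fE dfE gE dgE hE dhE /piola /cross /=.
rewrite !evE !hornerC halfX_z omega_chi//.
set G := (hat _ m.+1 _).[_]; set H := (hat _ l.+1 _).[_].
set F := (hat _ n.+2 _).[_]; set L := (legendre _ _).[_].
set J := (jacobi _ m _ _).[_]; set S := (jacobi _ l _ _).[_].
have := chi_halfX (chi p); set u := (halfX R).[chi p] => ->.
move: (omega_y p) (eta p) => v e; rewrite !exprMn !(exprS, exprD).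
by congr (_, _, _); rewrite /= /GRing.scale/=; field.
Qed.

Lemma legendre0 : legendre R 0 = 1.
Proof.
have := legendre_horner1 R 0; rewrite /legendre.
by rewrite [jacobi _ _ _ _]size1_polyC ?size_jacobi// hornerC => ->.
Qed.

Section FaceType.
Variables m l : nat.
Local Notation g := (@gN R m.+1).
Local Notation h := (@hN R m.+1 l.+1).

(** The weight [a] goes with g (grad h x v), and [b] with h curl(g v). The weights 1, 1 give curl(g
    h v). *)
Definition tri1 (a b : R) p : R3 :=
  (a * g p) *: cross (grad h p) (vN0 p) + (b * h p) *: cross (grad g p) (vN0 p)
  + (b * g p * h p) *: curl (@vN0 R) p.

Lemma vN0_line p v t : vN0 (t *: v + p) =
  vN0 p + t *: (- (1 / 8) *: (- 2 * v.1.2 - v.2, 2 * v.1.1, v.1.1)) :> R3.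
Proof.
by rewrite /vN0; congr (_, _, _); rewrite /= /GRing.scale/=; ring.
Qed.

Lemma is_derive_vN0 p v :
  [/\ is_derive (0 : R) 1 (fun t => (vN0 (t *: v + p)).1.1)
       (- (1 / 8) * (- 2 * v.1.2 - v.2)),
      is_derive (0 : R) 1 (fun t => (vN0 (t *: v + p)).1.2) (- (1 / 8) * (2 * v.1.1))
    & is_derive (0 : R) 1 (fun t => (vN0 (t *: v + p)).2) (- (1 / 8) * v.1.1)].
Proof.
split.
- rewrite (_ : (fun t => _) = fun t => (vN0 p).1.1 + t * (- (1 / 8) * (- 2 * v.1.2 - v.2))).
    exact: is_derive_affine.
  by apply/funext => t; rewrite vN0_line.
- rewrite (_ : (fun t => _) = fun t => (vN0 p).1.2 + t * (- (1 / 8) * (2 * v.1.1))).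
    exact: is_derive_affine.
  by apply/funext => t; rewrite vN0_line.
- rewrite (_ : (fun t => _) = fun t => (vN0 p).2 + t * (- (1 / 8) * v.1.1)).
    exact: is_derive_affine.
  by apply/funext => t; rewrite vN0_line.
Qed.

Lemma curl_vN0 p : curl (@vN0 R) p = (0, 1 / 4, - (1 / 2)).
Proof.
rewrite /curl.
have [x1 x2 x3] := is_derive_vN0 p (ex R); have [y1 y2 y3] := is_derive_vN0 p (ey R).
have [z1 z2 z3] := is_derive_vN0 p (ez R).
rewrite (derive_line x2) (derive_line x3) (derive_line y1) (derive_line y3).
rewrite (derive_line z1) (derive_line z2) /=.
by congr (_, _, _); field.
Qed.

Lemma derive_lineM (s r : R3 -> R) p v ds dr :
  is_derive (0 : R) 1 (fun t => s (t *: v + p)) ds ->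
  is_derive (0 : R) 1 (fun t => r (t *: v + p)) dr ->
  'D_v (fun q => s q * r q) p = s p * dr + r p * ds.
Proof.
move=> Ds Dr; apply: derive_line; have := is_deriveM Ds Dr.
by rewrite scale0r add0r.
Qed.

Lemma curl_scale_vanishing (s : R3 -> R) p :
  (forall v, vanishes_on_side (fun t => s (t *: v + p))) ->
  curl (fun q => s q *: vN0 q) p = 0.
Proof.
move=> H; have D (r : R3 -> R) v : 'D_v (fun q => s q * r q) p = 0.
  by apply: derive_vanishing; exact: vanishes_on_sideM (H v).
rewrite /curl (D (fun q => (vN0 q).1.1) (ey R)) (D (fun q => (vN0 q).1.1) (ez R)).
rewrite (D (fun q => (vN0 q).1.2) (ex R)) (D (fun q => (vN0 q).1.2) (ez R)).
rewrite (D (fun q => (vN0 q).2) (ex R)) (D (fun q => (vN0 q).2) (ey R)).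
by rewrite subrr.
Qed.

Lemma apex p : tet p -> omega_y p <= 0 -> p = (0, 0, 1).
Proof.
move=> tp v0; have [z1 z2 y1 y2 /andP[x1 x2]] := tet_bounds tp.
have vE : omega_y p = 0.
  by apply/eqP; rewrite eq_le v0 /omega_y; apply/andP; split => //; lra.
move: x1 x2 y1 y2; rewrite omegaE vE => x1 x2 y1 y2.
have y0 : p.1.2 = 0 by lra.
rewrite y0 in x1 x2.
have z0 : p.2 = 1 by move: vE; rewrite /omega_y; lra.
by rewrite [p]surjective_pairing [p.1]surjective_pairing y0 z0; congr (_, _, _); lra.
Qed.

Lemma apex_omega_y : omega_y ((0, 0, 1) : R3) = 0.
Proof. by rewrite /omega_y /= subrr mul0r. Qed.

Lemma vN0_apex : vN0 ((0, 0, 1) : R3) = 0.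
Proof. by rewrite /vN0; congr (_, _, _); rewrite /= /GRing.scale/=; ring. Qed.

Lemma gN_apex : g (0, 0, 1) = 0.
Proof. by rewrite /gN apex_omega_y expr0n mulr0. Qed.

(** In horizontal directions [omega_y] and so g stay 0. Along z the derivative of g need not vanish
    (m = 0), but g and [vN0] are both 0 at the apex, so the product rule gives 0. *)
Lemma curl_apex : curl (fun q => (g q * h q) *: vN0 q) (0, 0, 1) = 0.
Proof.
pose p : R3 := (0, 0, 1).
have V v : v.2 = 0 -> forall r : R3 -> R, 'D_v (fun q => (g q * h q) * r q) p = 0.
  move=> v0 r; apply: derive_vanishing; do 2 apply: vanishes_on_sideM.
  have E t : g (t *: v + p) = 0.
    by rewrite /gN omega_y_line apex_omega_y v0 mul0r oppr0 mulr0 addr0 expr0n mulr0.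
  by split; [exact: E | left; apply: nearW].
have dg : is_derive (0 : R) 1 (fun t => g (t *: ez R + p))
    (jacobi_hat m.+1 3 0 * (m.+1%:R * 0 ^+ m * (- (1 / 2)))).
  rewrite (_ : (fun t => _) = cst (jacobi_hat m.+1 3 0)
    * (fun t => 0 + t * (- (1 / 2))) ^+ m.+1); last first.
    apply/funext => t; rewrite /gN jhat_y_line apex_omega_y /= !mulr0 addr0.
    by rewrite /hom mul0r !fctE.
  have := is_deriveM (is_derive_cst (jacobi_hat m.+1 3 (0 : R)) (0 : R) 1)
    (is_deriveX m.+1 (is_derive_affine 0 (- (1 / 2)))).
  by rewrite /= mul0r addr0 scaler0 addr0.
have z1 : -1 < p.2 by rewrite /p /=; lra.
have dh := is_derive_h l (2 * m.+1 + 3) (ez R) z1.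
have dgh := is_deriveM dg dh.
have [c1 c2 c3] := is_derive_vN0 p (ez R).
have Z (r : R3 -> R) dr : r p = 0 ->
    is_derive (0 : R) 1 (fun t => r (t *: ez R + p)) dr ->
    'D_(ez R) (fun q => (g q * h q) * r q) p = 0.
  move=> r0 Dr; rewrite (@derive_lineM (fun q => g q * h q) r p _ _ _ dgh Dr).
  by rewrite gN_apex r0 !mul0r addr0.
rewrite /curl -/p (Z (fun q => (vN0 q).1.1) _ _ c1) ?vN0_apex//.
rewrite (Z (fun q => (vN0 q).1.2) _ _ c2) ?vN0_apex//.
rewrite (V (ex R) erefl (fun q => (vN0 q).1.2)) (V (ex R) erefl (fun q => (vN0 q).2)).
rewrite (V (ey R) erefl (fun q => (vN0 q).1.1)) (V (ey R) erefl (fun q => (vN0 q).2)).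
by rewrite subrr.
Qed.

Lemma tri1_in (a b : R) p : tet p -> box true false false p ->
  tri1 a b p = piola (hat R 1 0) (legendre R 0)
    (sc a (pr1A R m l) + sc b (pr1B R m l)) p.
Proof.
move=> tp; rewrite boxE//= andbT => /andP[z1 y1].
have [gE dgE] : g p = _ /\ grad g p = _ := g_in tp m 3 y1.
have [hE dhE] : h p = _ /\ grad h p = _ := h_in l (2 * m.+1 + 3) z1.
have ow : 1 - 2 * p.1.2 - p.2 = 4 * omega p by rewrite /omega; field.
rewrite /tri1 curl_vN0 gE dgE hE dhE /piola /cross /vN0 /= ow (eta_omega tp) legendre0 hornerC.
rewrite !evE !hornerC halfX_z omega_chi//.
set G := (hat _ m.+1 _).[_]; set H := (hat _ l.+1 _).[_].
set F := (hat _ 1 _).[_].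
set J := (jacobi _ m _ _).[_]; set S := (jacobi _ l _ _).[_].
have := chi_halfX (chi p); set u := (halfX R).[chi p] => ->.
move: (omega_y p) (eta p) => v e; rewrite !exprS.
by congr (_, _, _); rewrite /= /GRing.scale/=; field.
Qed.

Lemma gN_out p : tet p -> p.1.2 <= - omega_y p -> g p = 0.
Proof.
move=> tp y1; have [v0|v0] := ltP 0 (omega_y p).
  by have [] : g p = 0 /\ grad g p = 0 := g_out tp m 3 y1 v0.
by rewrite (apex tp v0) gN_apex.
Qed.

Lemma tri1_out (a b : R) p : tet p -> ~~ box true false false p -> tri1 a b p = 0.
Proof.
move=> tp; rewrite boxE//= andbT negb_and -!leNgt.
have [y1 _|y1] := leP p.1.2 (- omega_y p); last first.
  rewrite orbF => z1.
  have [h0 dh0] : h p = 0 /\ grad h p = 0 := h_out tp l (2 * m.+1 + 3) z1.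
  by rewrite /tri1 h0 dh0 !mulr0 !scale0r cross0v !scaler0 !addr0.
have g0 := gN_out tp y1; rewrite /tri1 g0 !mulr0 mul0r !scale0r add0r addr0.
have [v0|v0] := ltP 0 (omega_y p).
  have [_ ->] : g p = 0 /\ grad g p = 0 := g_out tp m 3 y1 v0.
  by rewrite cross0v scaler0.
(* At the apex the gradient of g is not known to vanish, but [vN0] does. *)
by rewrite (apex tp v0) vN0_apex crossv0 scaler0.
Qed.

Lemma curl_in p : tet p -> box true false false p ->
  curl (fun q => (g q * h q) *: vN0 q) p = tri1 1 1 p.
Proof.
move=> tp; rewrite boxE//= andbT => /andP[z1 y1].
pose dg v := is_derive_g tp m 3 v y1.
pose dh v := is_derive_h l (2 * m.+1 + 3) v z1.
have D (r : R3 -> R) v dr : is_derive (0 : R) 1 (fun t => r (t *: v + p)) dr ->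
    'D_v (fun q => (g q * h q) * r q) p =
    g p * h p * dr + r p * (g p * 'D_v h p + h p * 'D_v g p).
  move=> Dr; rewrite (derive_line (dg v)) (derive_line (dh v)).
  have dgh := is_deriveM (dg v) (dh v).
  rewrite (@derive_lineM (fun q => g q * h q) r p _ _ _ dgh Dr).
  by rewrite scale0r add0r.
have [x1 x2 x3] := is_derive_vN0 p (ex R); have [y1' y2 y3] := is_derive_vN0 p (ey R).
have [z1' z2 z3] := is_derive_vN0 p (ez R).
rewrite /tri1 curl_vN0 /curl.
rewrite (D (fun q => (vN0 q).1.2) _ _ x2) (D (fun q => (vN0 q).2) _ _ x3).
rewrite (D (fun q => (vN0 q).1.1) _ _ y1') (D (fun q => (vN0 q).2) _ _ y3).
rewrite (D (fun q => (vN0 q).1.1) _ _ z1') (D (fun q => (vN0 q).1.2) _ _ z2).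
rewrite /cross /grad; move: ('D_(ex R) g p) ('D_(ey R) g p) ('D_(ez R) g p).
move: ('D_(ex R) h p) ('D_(ey R) h p) ('D_(ez R) h p) => h1 h2 h3 g1 g2 g3.
move: (g p) (h p) (vN0 p) => g0 h0 w.
by congr (_, _, _); rewrite /= /GRing.scale/=; field.
Qed.

Lemma curl_out p : tet p -> ~~ box true false false p ->
  curl (fun q => (g q * h q) *: vN0 q) p = 0.
Proof.
move=> tp; rewrite boxE//= andbT negb_and -!leNgt.
have [y1 _|y1] := leP p.1.2 (- omega_y p); last first.
  rewrite orbF => z1; apply: curl_scale_vanishing => v.
  have := vanishes_on_sideM (fun t => g (t *: v + p))
    (vanishes_h tp l (2 * m.+1 + 3) v z1).
  by congr vanishes_on_side; apply/funext => t; rewrite mulrC.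
have [v0|v0] := ltP 0 (omega_y p).
  apply: curl_scale_vanishing => v; apply: vanishes_on_sideM.
  exact: (vanishes_g tp m 3 v y1 v0).
by rewrite (apex tp v0) curl_apex.
Qed.

End FaceType.

End PrimalExpansion.

(** * Components of the dual functions *)

Section DualExpansion.
Variable R : realType.
Local Notation R3 := (R * R * R)%type.
Local Notation Q := {poly {poly R}}.
Implicit Types (p d : R3) (n m l : nat) (E D : Q * Q * Q) (F L : {poly R}).

(** Prescribes the covariant components of [d], its products with the derivatives of (x, y, z) with
    respect to eta, chi, z; [piola] combines the same three vectors. Free of divisions, it also
    makes sense where [omega] or [omega_y] is 0. *)
Definition copiola L D p d : Prop :=
  [/\ omega p * d.1.1 = - 2 * (L^`()).[eta p] * ev (chi p) p.2 D.1.1,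
      omega_y p * (d.1.2 - eta p / 2 * d.1.1) = L.[eta p] * ev (chi p) p.2 D.1.2
    & d.2 - chi p / 2 * d.1.2 - eta p * (1 - chi p) / 4 * d.1.1 =
      L.[eta p] * ev (chi p) p.2 D.2].

Lemma copiolaD L D D' p d d' :
  copiola L D p d -> copiola L D' p d' -> copiola L (D + D') p (d + d').
Proof.
move=> [a1 a2 a3] [b1 b2 b3]; split; rewrite /= !evE [RHS]mulrDr.
- by rewrite -a1 -b1; ring.
- by rewrite -a2 -b2; ring.
- by rewrite -a3 -b3; ring.
Qed.

Lemma copiolaZ c L D p d : copiola L D p d -> copiola L (sc c D) p (c *: d).
Proof.
move=> [a1 a2 a3]; split; rewrite /= !evE hornerC [RHS]mulrCA /GRing.scale/=.
- by rewrite -a1; ring.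
- by rewrite -a2; ring.
- by rewrite -a3; ring.
Qed.

Lemma dot_piola F L L' E D p d : copiola L' D p d ->
  dot (piola F L E p) d =
  (- 2 *: (F * L'^`())).[eta p] * ev (chi p) p.2 (E.1.1 * D.1.1)
  + (L * L').[eta p] * ev (chi p) p.2 (E.1.2 * D.1.2 + E.2 * D.2).
Proof.
move=> [a1 a2 a3]; rewrite hornerZ !hornerM evD !evM /dot /piola /=.
set A := ev _ _ E.1.1; set B := ev _ _ E.1.2; set C := ev _ _ E.2.
transitivity (F.[eta p] * A * (omega p * d.1.1)
  + L.[eta p] * B * (omega_y p * (d.1.2 - eta p / 2 * d.1.1))
  + L.[eta p] * C * (d.2 - chi p / 2 * d.1.2 - eta p * (1 - chi p) / 4 * d.1.1)).
  by field.
by rewrite a1 a2 a3; ring.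
Qed.

Section DualI.
Variables (n m l : nat) (p : R3).
Hypothesis tp : tet p.

Lemma copiola_bI :
  copiola (legendre R n.+1) (duA R n m l) p (bI_aux n.+2 m.+1 l.+1 p).
Proof.
have L' : ((legendre R n.+1)^`()).[eta p] =
    n.+2%:R / 2 * (jacobi R n 1 1).[eta p].
  by rewrite /legendre deriv_jacobi hornerZ !addn0 addn2.
have P1 : (jacobi R n.+1 1 1).[eta p] = 2 * (n.+2%:R * (legendre R n.+1).[eta p]
    + eta p * (n.+2%:R / 2 * (jacobi R n 1 1).[eta p])) / (n.+2%:R + 1).
  have := congr1 (fun q : {poly R} => q.[eta p]) (legendre_deriv_rec R n.+1).
  rewrite hornerD hornerN hornerM hornerX hornerZ L' /legendre deriv_jacobi hornerZ.
  rewrite !addn0 addn2 => <-.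
  have h : n.+2%:R + 1 != 0 :> R by rewrite natr1 pnatr_eq0.
  by rewrite -[n.+3%:R]natr1; field.
rewrite /copiola L' /bI_aux !subSS !subn0 P1 /= !evE !hornerC halfX_z omega_chi//.
set L := (legendre _ _).[_]; set P := (jacobi R n 1 1).[_].
set J := (jacobi _ m _ _).[_]; set S := (jacobi _ l _ _).[_].
have h : n.+2%:R + 1 != 0 :> R by rewrite natr1 pnatr_eq0.
have := chi_halfX (chi p); set u := (halfX R).[chi p] => ->.
move: (omega_y p) (eta p) => v e; rewrite !exprMn !(exprS, exprD).
by split; rewrite /= /GRing.scale/=; field.
Qed.

Lemma copiola_bII :
  copiola (legendre R n.+1) (duB R n m l) p (bII_aux n.+2 m.+1 l.+1 p).
Proof.
have h : 2 * n.+2%:R + m.+1%:R - 1 != 0 :> R.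
  rewrite (_ : _ - 1 = (2 * n.+2 + m)%:R) ?pnatr_eq0//.
  by rewrite natrD natrM -[m.+1%:R]natr1; ring.
rewrite /copiola /bII_aux /R_aux !subSS !subn0 /= !evE !hornerC halfX_z omega_chi//.
set L := (legendre _ _).[_]; set L' := (_^`()).[_].
set P := (jacobi R m (_ - 1) 1).[_].
set J := (jacobi _ m _ _).[_]; set S := (jacobi _ l _ _).[_].
have := chi_halfX (chi p); set u := (halfX R).[chi p] => ->.
move: (omega_y p) (eta p) => v e; rewrite !exprMn !(exprS, exprD).
by split; rewrite /= /GRing.scale/=; field.
Qed.

Lemma copiola_bIII :
  copiola (legendre R n.+1) (duC R n m l) p (bIII_aux n.+2 m.+1 l.+1 p).
Proof.
rewrite /copiola /bIII_aux !subSS !subn0 /= !evE !hornerC halfX_z omega_chi//.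
set L := (legendre _ _).[_]; set L' := (_^`()).[_].
set J := (jacobi _ m _ _).[_]; set S := (jacobi _ l _ _).[_].
have := chi_halfX (chi p); set u := (halfX R).[chi p] => ->.
move: (omega_y p) (eta p) => v e; rewrite !exprMn !(exprS, exprD).
by split; rewrite /= /GRing.scale/=; field.
Qed.

Lemma copiola_b1I :
  copiola (legendre R 0) (du1A R m l) p (b1I_aux m.+1 l.+1 p).
Proof.
have := congr1 (fun q : {poly R} => q.[chi p]) (jacobi21_add_jacobi11 R m).
rewrite hornerD hornerZ hornerM hornerD hornerN hornerX hornerC => S10.
rewrite legendre0 /copiola derivC !hornerC /b1I_aux !subSS !subn0 /= !evE !hornerC.
rewrite halfX_z -S10.
by split; rewrite /= /GRing.scale/= !exprS; field.
Qed.

Lemma copiola_b1IV :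
  copiola (legendre R 0) (du1B R m l) p (b1IV_aux m.+1 l.+1 p).
Proof.
rewrite legendre0 /copiola derivC !hornerC /b1IV_aux !subSS !subn0 /= !evE !hornerC.
rewrite halfX_z.
by split; rewrite /= /GRing.scale/= !exprS; ring.
Qed.

Lemma copiola_b10 :
  copiola (legendre R 0) (du10 R l) p ((jacobi R l 3 1).[p.2] *: ((0, 0, 1) : R3)).
Proof.
rewrite legendre0 /copiola derivC !hornerC /= !evE.
by split; rewrite /= /GRing.scale/=; ring.
Qed.

Lemma w10_piola :
  w10 l.+1 p = piola (hat R 1 0) (legendre R 0) (pr10 R l) p.
Proof.
have [z1 _ _ _ _] := tet_bounds tp.
have zE : 1 - p.2 = 2 * omega_y p by rewrite /omega_y; field.
rewrite /w10 /wF1 jacobi_hatE// /piola legendre0 hornerC /= !evE halfX_z.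
rewrite zE (eta_omega tp) (chi_omega_y tp) omega_chi//.
set H := (hat _ l.+1 _).[_]; set F := (hat _ 1 _).[_].
have := chi_halfX (chi p); set u := (halfX R).[chi p] => ->.
move: (omega_y p) (eta p) => v e.
by congr (_, _, _); rewrite /= /GRing.scale/=; field.
Qed.

End DualI.

End DualExpansion.

(** * Biorthogonality *)

Section Assembly.
Variable R : realType.
Local Notation R3 := (R * R * R)%type.
Local Notation Q := {poly {poly R}}.
Local Notation L n := (legendre R n).
Implicit Types (s t : bubble) (p : R3) (i j k n m l : nat) (a b c x y z : R).

Definition bubble_i s : nat :=
  match s with TypeI i _ _ | TypeII i _ _ | TypeIII i _ _ => i | _ => 1 end.

Definition pr3 a b c n m l : Q * Q * Q :=
  sc a (prA R n m l) + sc b (prB R n m l) + sc c (prC R n m l).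

Definition du3 c x y z n m l : Q * Q * Q :=
  sc c (sc x (duA R n m l) + sc y (duB R n m l) + sc z (duC R n m l)).

Definition pr2 a b m l : Q * Q * Q := sc a (pr1A R m l) + sc b (pr1B R m l).

Definition du2 c x y m l : Q * Q * Q :=
  sc c (sc x (du1A R m l) + sc y (du1B R m l)).

Definition primal_coef s : Q * Q * Q :=
  match s with
  | TypeI i j k => pr3 i%:R j%:R k%:R i.-2 j.-1 k.-1
  | TypeII i j k => pr3 i%:R j%:R (- (i%:R + j%:R)) i.-2 j.-1 k.-1
  | TypeIII i j k => pr3 (- i%:R) (i%:R + k%:R) (- k%:R) i.-2 j.-1 k.-1
  | Type1I j k => pr2 (j%:R + 2) (- k%:R) j.-1 k.-1
  | Type1IV j k => pr2 1 1 j.-1 k.-1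
  | Type10 k => pr10 R k.-1
  end.

Definition dual_coef s : Q * Q * Q :=
  match s with
  | TypeI i j k => du3 (c_coef R i j k) i%:R i%:R i%:R i.-2 j.-1 k.-1
  | TypeII i j k => du3 (c_coef R i j k) k%:R 0 (- i%:R) i.-2 j.-1 k.-1
  | TypeIII i j k => du3 (c_coef R i j k) (- j%:R) i%:R 0 i.-2 j.-1 k.-1
  | Type1I j k => du2 (d_coef R j k) 1 (- 1) j.-1 k.-1
  | Type1IV j k => du2 (d_coef R j k) k%:R (j%:R + 2) j.-1 k.-1
  | Type10 k => sc (- ((2 * k%:R + 3) * (k%:R + 3) / 8))^-1 (du10 R k.-1)
  end.

(** The flags exclude the faces on which some [jacobi_hat] is differentiated: all three for i >= 2,
    those in y and z for the types with g and h only, none for [Type10], which involves no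
    derivative. *)
Lemma primal_piola s : in_range s -> exists e1 e2 e3, forall p, tet p ->
  primal R s p = if box e1 e2 e3 p then
    piola (hat R (bubble_i s) 0) (L (bubble_i s).-1) (primal_coef s) p else 0.
Proof.
case: s => [i j k|i j k|i j k|j k|j k|k] /=.
- case: i j k => [|[|n]] [|m] [|l]//= _; exists false, false, false => p tp.
  by rewrite -triE.
- case: i j k => [|[|n]] [|m] [|l]//= _; exists false, false, false => p tp.
  by rewrite -triE// /wII /tri !mulNr !scaleNr.
- case: i j k => [|[|n]] [|m] [|l]//= _; exists false, false, false => p tp.
  by rewrite -triE// /wIII /tri !mulNr !scaleNr.
- case: j k => [|m] [|l]//= _; exists true, false, false => p tp.
  rewrite -[w1I _ _ _]/(_) (_ : w1I m.+1 l.+1 p = tri1 m l (m.+1%:R + 2) (- l.+1%:R) p).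
    by case: ifPn => bp; [rewrite tri1_in | rewrite tri1_out].
  by rewrite /w1I /tri1 !mulNr !scaleNr.
- case: j k => [|m] [|l]//= _; exists true, false, false => p tp.
  by case: ifPn => bp; [rewrite -tri1_in// -curl_in | exact: curl_out].
- case: k => [|l]//= _; exists true, true, true => p tp.
  by move/tetP: (tp) => ->; rewrite w10_piola.
Qed.

Lemma dual_copiola s p : in_range s -> tet p ->
  copiola (L (bubble_i s).-1) (dual_coef s) p (dual R s p).
Proof.
move=> + tp; case: s => [i j k|i j k|i j k|j k|j k|k] /=.
- case: i j k => [|[|n]] [|m] [|l]//= _; apply: copiolaZ.
  apply: copiolaD; last exact/copiolaZ/copiola_bIII.
  by apply: copiolaD; [exact/copiolaZ/copiola_bI | exact/copiolaZ/copiola_bII].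
- case: i j k => [|[|n]] [|m] [|l]//= _; apply: copiolaZ.
  (* A zero multiple of the missing auxiliary function is inserted to fit the shape of [du3]. *)
  rewrite -scaleNr -[l.+1%:R *: _]addr0 -(scale0r (bII_aux n.+2 m.+1 l.+1 p)).
  apply: copiolaD; last exact/copiolaZ/copiola_bIII.
  by apply: copiolaD; [exact/copiolaZ/copiola_bI | exact/copiolaZ/copiola_bII].
- case: i j k => [|[|n]] [|m] [|l]//= _; apply: copiolaZ.
  rewrite -[X in copiola _ _ _ X]addr0 -(scale0r (bIII_aux n.+2 m.+1 l.+1 p)).
  apply: copiolaD; last exact/copiolaZ/copiola_bIII.
  by apply: copiolaD; [exact/copiolaZ/copiola_bI | exact/copiolaZ/copiola_bII].
- case: j k => [|m] [|l]//= _; apply: copiolaZ.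
  rewrite -[b1I_aux _ _ _]scale1r -(scaleN1r (b1IV_aux m.+1 l.+1 p)).
  by apply: copiolaD; [exact/copiolaZ/copiola_b1I | exact/copiolaZ/copiola_b1IV].
- case: j k => [|m] [|l]//= _; apply: copiolaZ.
  by apply: copiolaD; [exact/copiolaZ/copiola_b1I | exact/copiolaZ/copiola_b1IV].
- case: k => [|l]//= _; rewrite /b10 subn1; apply: copiolaZ; exact: copiola_b10.
Qed.

(** By parts: from index 2 on, the integrated Legendre polynomial vanishes at both ends. *)
Lemma integ_hat_deriv_legendre n q :
  integ (- 2 *: (hat R n.+2 0 * q^`())) = 2 * integ (L n.+1 * q).
Proof.
rewrite linearZ/= mulrC -[hat _ _ _ * _]mulrC integ_by_parts.
rewrite !hornerM hat_horner1// hat_hornerN1 !mulr0 subrr sub0r deriv_hat /=.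
by rewrite mulrN mulNr opprK mulrC [q * _]mulrC.
Qed.

Lemma pairing_gram s t : in_range s -> in_range t ->
  pairing_integrable (primal R s) (dual R t) /\
  pairing (primal R s) (dual R t) =
    integ (L (bubble_i s).-1 * L (bubble_i t).-1) * gram (primal_coef s) (dual_coef t).
Proof.
move=> rs rt; have [e1 [e2 [e3 pE]]] := primal_piola rs.
set E := primal_coef s; set D := dual_coef t.
set F := hat R (bubble_i s) 0; set Ls := L (bubble_i s).-1; set Lt := L (bubble_i t).-1.
have [|pi ->] := @pairing_box R e1 e2 e3 (primal R s) (dual R t)
  (- 2 *: (F * Lt^`())) (E.1.1 * D.1.1) (Ls * Lt) (E.1.2 * D.1.2 + E.2 * D.2).
  move=> p tp; rewrite /bev pE//; case: ifP => _.
    exact: dot_piola (dual_copiola rt tp).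
  by rewrite /dot /= !mul0r !addr0.
split=> //.
have gE : gram E D = 2 * int2 (E.1.1 * D.1.1) + int2 (E.1.2 * D.1.2 + E.2 * D.2).
  rewrite /gram (_ : form E D = (2 : R)%:P%:P * (E.1.1 * D.1.1)
    + (E.1.2 * D.1.2 + E.2 * D.2)); first by rewrite raddfD/= int2Z.
  by rewrite /form !polyC_natr; ring.
rewrite gE [RHS]mulrDr; congr (_ + _).
have [i1|[i2 E0]] : (1 < bubble_i s)%N \/ (bubble_i s = 1 /\ E.1.1 = 0).
- rewrite /E; case: (s) rs => [i j k|i j k|i j k|j k|j k|k] /=;
    try by move=> /andP[]; left.
  + by move=> _; right; split=> //; rewrite !mulr0 addr0.
  + by move=> _; right; split=> //; rewrite !mulr0 addr0.
  + by move=> _; right.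
- rewrite /F /Ls; case: (bubble_i s) i1 => [|[|n]]// _.
  by rewrite integ_hat_deriv_legendre /=; ring.
- by rewrite E0 mul0r raddf0 !mulr0.
Qed.

Lemma integ_legendre n m : integ (L n * L m) = (n == m)%:R * nrm R n 0.
Proof. by rewrite -integ_jacobi expr0 mul1r. Qed.

Definition gramE := (gramDl, gramDr, gramZl, gramZr, gramAA, gramAB, gramAC,
  gramBA, gramBB, gramBC, gramCA, gramCB, gramCC, gram1AA, gram1AB, gram1BA, gram1BB,
  gram1A0, gram1B0, gram01A, gram01B, gram00).

Lemma gram_pr3_du3 a b c (d : R) x y z n m l m' l' :
  gram (pr3 a b c n m l) (du3 d x y z n m' l') =
  ((m == m') && (l == l'))%:R * (d * (a * x + b * y + c * z) * kap R n m l).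
Proof. by rewrite /pr3 /du3 !gramE; ring. Qed.

Lemma gram_pr2_du2 a b (d : R) x y m l m' l' :
  gram (pr2 a b m l) (du2 d x y m' l') =
  - (((m == m') && (l == l'))%:R * (d * (a * x + b * y) * kap1 R m l)).
Proof. by rewrite /pr2 /du2 !gramE; ring. Qed.

Lemma c_coef_neq0 i j k : (0 < i)%N -> c_coef R i j k != 0.
Proof.
case: i => // n _.
have h q : 2 * n.+1%:R + q%:R - 1 != 0 :> R.
  rewrite (_ : _ - 1 = (2 * n + q).+1%:R) ?pnatr_eq0//.
  by rewrite -!natr1 natrD natrM; ring.
rewrite /c_coef !mulf_neq0 ?invr_neq0 ?mulf_neq0 ?pnatr_eq0//.
Qed.

Lemma d_coef_neq0 j k : d_coef R j k != 0.
Proof.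
rewrite /d_coef oppr_eq0 !mulf_neq0 ?invr_neq0 ?mulf_neq0 ?pnatr_eq0 ?natr1 -?natrD
  ?pnatr_eq0 ?addn1 ?addn2//.
Qed.

(** For i >= 2 the vectors (i, j, k), (i, j, -i-j), (-i, i+k, -k) are biorthogonal to (i, i, i), (k,
    0, -i), (-j, i, 0); for i = 1, (j+2, -k), (1, 1) are biorthogonal to (1, -1), (k, j+2). *)
Lemma gram_neq s t : in_range s -> in_range t -> bubble_i s = bubble_i t -> s <> t ->
  gram (primal_coef s) (dual_coef t) = 0.
Proof.
have h3 a b c (d : R) x y z n m l m' l' :
    (m = m' -> l = l' -> a * x + b * y + c * z = 0) ->
    gram (pr3 a b c n m l) (du3 d x y z n m' l') = 0.
  move=> H; rewrite gram_pr3_du3; have [/andP[/eqP e1 /eqP e2]|] := boolP (_ && _).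
    by rewrite H// mulr0 mul0r mulr0.
  by rewrite mul0r.
have h2 a b (d : R) x y m l m' l' : (m = m' -> l = l' -> a * x + b * y = 0) ->
    gram (pr2 a b m l) (du2 d x y m' l') = 0.
  move=> H; rewrite gram_pr2_du2; have [/andP[/eqP e1 /eqP e2]|] := boolP (_ && _).
    by rewrite H// mulr0 mul0r mulr0 oppr0.
  by rewrite mul0r oppr0.
(* A range selector moves the goals it selects to the front. *)
case: s => [i j k|i j k|i j k|j k|j k|k]; case: t => [i' j' k'|i' j' k'|i' j' k'|j' k'|j' k'|k'].
1-3,7-9,13-15: move=> /and3P[_ + +] /and3P[_ + +]; rewrite /primal_coef /dual_coef /=.
1-9: move=> + + + + <-; case: j k j' k' => [|j] [|k] [|j'] [|k']// _ _ _ _ ne;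
  apply: h3 => /= e1 e2; subst j' k'.
1,5,9: by case: ne.
1-6: ring.
1-9: move=> rs rt e _; exfalso; move: rs rt e => /=.
1-9: by move=> /andP[+ _] _ e; rewrite e.
1-3,7-9,13-15: move=> rs rt e _; exfalso; move: rs rt e => /=.
1-9: by move=> _ /andP[+ _] e; rewrite -e.
1-2,4-5: move=> /andP[+ +] /andP[+ +] _;
  case: j k j' k' => [|j] [|k] [|j'] [|k']// _ _ _ _ ne; apply: h2 => /= e1 e2; subst j' k'.
1,4: by case: ne.
1-2: ring.
1-4: by move=> *; rewrite /primal_coef /dual_coef /pr2 /du2 !gramE !(mulr0, addr0).
case: k k' => [|k] [|k']//= _ _ _ ne; rewrite !gramE.
by have [e|] := eqVneq k k'; [case: ne; rewrite e | rewrite mul0r mulr0].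
Qed.

(** Each of these vectors has product i(i+j+k) with its own dual, or j+k+2 for i = 1: the factors in
    the denominators of [c_coef] and [d_coef]. *)
Lemma gram_self s : in_range s -> gram (primal_coef s) (dual_coef s) != 0.
Proof.
have h3 a b c (d : R) x y z n m l r : d != 0 -> (0 < r)%N ->
    a * x + b * y + c * z = r%:R -> gram (pr3 a b c n m l) (du3 d x y z n m l) != 0.
  move=> d0 r0 e; rewrite gram_pr3_du3 !eqxx mul1r e.
  by rewrite mulf_neq0 ?kap_neq0// mulf_neq0// pnatr_eq0 -lt0n.
have h2 a b (d : R) x y m l r : d != 0 -> (0 < r)%N -> a * x + b * y = r%:R ->
    gram (pr2 a b m l) (du2 d x y m l) != 0.
  move=> d0 r0 e; rewrite gram_pr2_du2 !eqxx mul1r e oppr_eq0.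
  by rewrite mulf_neq0 ?kap1_neq0// mulf_neq0// pnatr_eq0 -lt0n.
case: s => [i j k|i j k|i j k|j k|j k|k] rs.
1-3: have i0 : (0 < i)%N by case/and3P: rs => /ltnW.
1-3: by apply: (@h3 _ _ _ _ _ _ _ _ _ _ (i * (i + j + k))%N); rewrite ?c_coef_neq0//;
  [rewrite muln_gt0 !addn_gt0 i0 | rewrite natrM !natrD; ring].
1-2: by apply: (@h2 _ _ _ _ _ _ _ (j + k + 2)%N); rewrite ?d_coef_neq0//;
  [rewrite addn2 | rewrite !natrD; ring].
case: k rs => [|l]//= _; rewrite !gramE eqxx mul1r mulf_neq0 ?kap10_neq0//.
Qed.

End Assembly.

Theorem theorem5p5 (R : realType) :
  (forall s t : bubble, in_range s -> in_range t ->
     pairing_integrable (primal R s) (dual R t)) /\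
  (forall s t : bubble, in_range s -> in_range t -> s <> t ->
     pairing (primal R s) (dual R t) = 0) /\
  (forall s : bubble, in_range s ->
     pairing (primal R s) (dual R s) <> 0).
Proof.
split; first by move=> s t rs rt; have [] := pairing_gram R rs rt.
have i_gt0 s : in_range s -> (0 < bubble_i s)%N.
  by case: s => [i j k|i j k|i j k|j k|j k|k] //= /and3P[/ltnW].
split.
- move=> s t rs rt st; have [_ ->] := pairing_gram R rs rt.
  (* For different i the triples have unrelated weights, and it is the Legendre factor that
     vanishes; its degree is i - 1, so positivity of i is needed to separate the degrees. *)
  have [e|ne] := eqVneq (bubble_i s) (bubble_i t).
    by rewrite gram_neq// mulr0.
  rewrite integ_legendre (_ : (_ == _) = false) ?mul0r//.
  apply/negbTE; apply: contra ne => /eqP e.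
  by rewrite -(prednK (i_gt0 s rs)) -(prednK (i_gt0 t rt)) e.
- move=> s rs; have [_ ->] := pairing_gram R rs rs; apply/eqP.
  by rewrite integ_legendre eqxx mul1r mulf_neq0 ?nrm_neq0 ?gram_self.
Qed.
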